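(* Let $n\ge 2$, let $\Lambda=\mathrm{diag}(\lambda_1<\cdots<\lambda_n)$, and let $F:\mathcal{T}_\Lambda\to\mathcal{T}_\Lambda$ be a continuous $\mathcal{E}$-equivariant map such that every diagonal matrix in $\mathcal{T}_\Lambda$ is a fixed point of $F$. (a) The map $F$ is surjective. (b) If there exist pairwise disjoint compact sets $\mathcal{K}_i\subset\mathcal{T}_\Lambda$, $i=1,\dots,n$, with $\mathcal{K}_i\supset\mathcal{D}^i_{\Lambda,0}$ and $F(\mathcal{K}_i)\subset\mathrm{int}(\mathcal{K}_i)$, then there exists $T\in\mathcal{T}_\Lambda$ for which the sequence $(F^k(T))_{k\in\mathbb{N}}$ does not undergo bottom deflation.
   Context: $\mathcal{T}_\Lambda$ is the set of real symmetric tridiagonal $n\times n$ matrices with spectrum $\{\lambda_1,\dots,\lambda_n\}$ (a connected compact smooth manifold), with $\lambda_1<\dots<\lambda_n$ real; interiors are taken in $\mathcal{T}_\Lambda$. $\mathcal{E}$ is the group of diagonal matrices with diagonal entries $\pm1$; $F$ is $\mathcal{E}$-equivariant if $F(ETE)=E\,F(T)\,E$ for all $T\in\mathcal{T}_\Lambda$, $E\in\mathcal{E}$. For $T\in\mathcal{T}_\Lambda$ put $b(T)=(T)_{n,n-1}$. The deflation sets are $\mathcal{D}^i_{\Lambda,0}=\{T\in\mathcal{T}_\Lambda : b(T)=0,\ (T)_{n,n}=\lambda_i\}$. The sequence $(F^k(T))$ undergoes bottom deflation if $\lim_{k\to+\infty} b(F^k(T))=0$. *)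

(* Defs.v *)
From mathcomp Require Export all_boot all_order all_algebra.
From mathcomp Require Export all_classical all_reals all_analysis.
Export numFieldNormedType.Exports.

Set Implicit Arguments.
Unset Strict Implicit.
Unset Printing Implicit Defensive.

Import Order.TTheory GRing.Theory Num.Theory.
Local Open Scope classical_set_scope.
Local Open Scope ring_scope.

Definition is_tridiag_mx (R : realType) (n : nat) (T : 'M[R]_n) : Prop :=
  forall i j : 'I_n, (i.+1 < j)%N || (j.+1 < i)%N -> T i j = 0.

(* The [lam i] are always assumed pairwise distinct below, so equality of the
   set of eigenvalues with the range of [lam] determines the multiplicities. *)
Definition isospectral (R : realType) (n : nat) (lam : 'I_n -> R) :
    set 'M[R]_n :=
  [set T | [/\ T^T = T, is_tridiag_mx T
             & [set a | eigenvalue T a] = range lam]].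

Definition sign_mx (R : realType) (n : nat) : set 'M[R]_n :=
  [set diag_mx e | e in
    [set e : 'rV[R]_n | forall i, e ord0 i = 1 \/ e ord0 i = -1]].

(* Only the values of [F] on the isospectral set matter: a self-map of that set
   is represented by a total function preserving it. *)
Definition sign_equivariant (R : realType) (n : nat) (lam : 'I_n -> R)
    (F : 'M[R]_n -> 'M[R]_n) : Prop :=
  forall T E : 'M[R]_n, isospectral lam T -> sign_mx E ->
    F (E *m T *m E) = E *m F T *m E.

(* Matrices have size n + 2 with indices starting at 0, so [ord_max] is the last
   index and [inord n] the one before it. *)
Definition bottom (R : realType) (n : nat) (T : 'M[R]_n.+2) : R :=
  T ord_max (inord n).

Definition deflation_set (R : realType) (n : nat) (lam : 'I_n.+2 -> R)
    (i : 'I_n.+2) : set 'M[R]_n.+2 :=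
  [set T | [/\ isospectral lam T, bottom T = 0 & T ord_max ord_max = lam i]].

Definition bottom_deflation (R : realType) (n : nat)
    (F : 'M[R]_n.+2 -> 'M[R]_n.+2) (T : 'M[R]_n.+2) : Prop :=
  bottom (iter k F T) @[k --> \oo] --> (0 : R).

Definition relative_interior (X : topologicalType) (A K : set X) : set X :=
  @interior (subspace A) K.

(* Main.v *)
Require Import Defs.
From mathcomp Require Import fingroup perm ring lra zify.

(** Surjectivity.  The squared first components of the unit eigenvectors of [T]
    form a weight vector in a simplex.  Up to conjugation by sign matrices, the
    weights identify the matrices with nonzero subdiagonal with the points of
    the open simplex ([inverse_spectral], [weight_inj]).  A map [F] as in the
    theorem acts on weights, and the key fact is that a vanishing weight of [T]
    also vanishes for [F T] ([weight0_selfmap]), so that [F] behaves like a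
    self-map of a simplex preserving every face, which must be onto.

    To see that faces are preserved, note that a vanishing weight means that [T]
    splits into two blocks.  Equivariance forces [F T] to split at the same
    place, and the set of eigenvalues carried by the upper block is a discrete
    invariant.  It is constant along a path from [T] to a diagonal matrix on
    which the splitting persists ([path_to_diagonal]), and [F] fixes the
    endpoint.

    That a face-preserving map reaches every interior point [p] is proved by a
    Knaster-Kuratowski-Mazurkiewicz argument.  A grid point is labelled by an
    index at which the weight of the image does not exceed [p], and a full
    cluster of labels ([grid_scarf]) yields in the limit a matrix at which no
    weight of the image exceeds [p]; as weights sum to one, they are equal to
    [p] ([weights_onto]).  The combinatorial input is the lemma of Scarf on
    dominant sets for finitely many linear orders ([scarf]), proved by counting
    doors modulo two; it replaces Sperner's lemma and needs no triangulation.

    Hence the image contains all matrices with nonzero subdiagonal.  These are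
    dense and the image is compact ([selfmap_surj]).

    Both density and paths come from one family of charts.  Given a diagonal
    matrix with entries [mu] and subdiagonal parameters [beta], a lower
    bidiagonal matrix has an explicit unit lower triangular matrix [L] of left
    eigenvectors; if [L = Q P] with [Q] orthogonal and [P] upper triangular, then
    conjugating the diagonal matrix by [Q] gives a symmetric tridiagonal matrix
    whose subdiagonal vanishes exactly where [beta] does.  The factorization
    [L U] with row exchanges shows that every matrix arises in this way for some
    ordering of the spectrum ([chart_cover]).  Multiplying [beta] by [t] in
    [[0, 1]] gives the paths, and replacing its zeros by small numbers gives
    density.

    Non-deflation.  Suppose that every orbit deflates.  A limit point of an orbit
    lies in some deflation set, so the orbit enters the interior of one of the
    traps [K i].  The basins of the traps are open, pairwise disjoint and cover
    everything, but turning the last two vectors of an eigenbasis into each other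
    gives a path between two distinct deflation sets, and a path is connected
    ([non_deflating]). *)

Set Implicit Arguments.
Unset Strict Implicit.
Unset Printing Implicit Defensive.
Import Order.TTheory GRing.Theory Num.Theory.

(** * Dominant sets for finitely many linear orders *)

Section Scarf.
Import fintype finset.
Local Notation set0 := finset.set0.
Variables (T I : finType) (r : I -> T -> nat).
Hypothesis r_inj : forall i, injective (r i).
Implicit Types (D : {set T}) (C : {set I}).

(** A linear order on the points is given by the injective rank [r i]. *)
Definition below i D t := [forall d in D, r i t <= r i d].

(** The dominant pairs of Scarf.  The cells and doors below play the part of the
    maximal simplices and of the facets of a triangulation. *)
Definition dominant D C := [forall t, [exists i in C, below i D t]].

Definition cell (s : {set T} * {set I}) := dominant s.1 s.2 && (#|s.1| == #|s.2|).

Definition door (s : {set T} * {set I}) :=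
  dominant s.1 s.2 && (#|s.2| == #|s.1|.+1).

Definition incident (d s : {set T} * {set I}) :=
  (d.1 \subset s.1) && (s.2 \subset d.2).

Lemma belowP i D t :
  reflect (forall d, d \in D -> r i t <= r i d) (below i D t).
Proof. exact: forall_inP. Qed.

Lemma dominantP D C :
  reflect (forall t, exists2 i, i \in C & below i D t) (dominant D C).
Proof. by apply: (iffP forallP) => h t; have /exists_inP := h t. Qed.

Lemma dominantW D C D' C' :
  D' \subset D -> C \subset C' -> dominant D C -> dominant D' C'.
Proof.
move=> DD CC /dominantP h; apply/dominantP => t; have [i iC /belowP it] := h t.
exists i; first exact: subsetP CC _ iC.
by apply/belowP => d dD; apply: it; exact: subsetP DD _ dD.
Qed.

Lemma below_uniq i D d e :
  d \in D -> e \in D -> below i D d -> below i D e -> d = e.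
Proof.
move=> dD eD /belowP id /belowP ie; apply: (@r_inj i).
by apply/eqP; rewrite eqn_leq id// ie.
Qed.

Lemma below_min i D : D != set0 -> exists2 d, d \in D & below i D d.
Proof.
move=> /set0Pn[d0 d0D].
case: (@arg_minnP _ d0 (mem D) (r i) d0D) => d dD dmin.
by exists d => //; apply/belowP.
Qed.

Definition covers D C := forall d, d \in D -> exists2 l, l \in C & below l D d.

Lemma dominant_covers D C : dominant D C -> covers D C.
Proof. by move=> /dominantP h d _; exact: h. Qed.

(** Each order has a single minimum on [D]. *)
Lemma covers_card D C : covers D C -> #|D| <= #|C|.
Proof.
move=> cov; have [->|[t0 t0D]] := set_0Vmem D; first by rewrite cards0.
pose g l := odflt t0 [pick d in D | below l D d].
apply: leq_trans (leq_imset_card g (mem C)); apply/subset_leq_card/subsetP => d dD.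
have [l lC ld] := cov d dD; apply/imsetP; exists l => //.
rewrite /g; case: pickP => [e /andP[eD le]|/(_ d)] /=.
  exact: below_uniq ld le.
by rewrite dD ld.
Qed.

(** In a cell there are as many orders as points and every point is a minimum,
    so distinct orders have distinct minima. *)
Lemma cell_min_inj D C i j d : cell (D, C) -> i \in C -> j \in C -> d \in D ->
  below i D d -> below j D d -> i = j.
Proof.
move=> /andP[/= /dominant_covers cov /eqP DC] iC jC dD id jd.
apply/eqP; apply: contraT => ij.
suff /covers_card : covers D (C :\ i) by rewrite DC (cardsD1 i C) iC; lia.
move=> e eD; have [l lC le] := cov e eD; have [li|li] := eqVneq l i.
  exists j; first by rewrite !inE eq_sym ij.
  by rewrite (_ : e = d)//; apply: (@below_uniq i D) => //; rewrite -li.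
by exists l => //; rewrite !inE li.
Qed.

(** A door has one order more than points, so two orders share their minimum;
    these two indices name the two sides of the door. *)
Lemma door_pair D C : door (D, C) -> D != set0 ->
  exists i j y, [/\ i \in C, j \in C, i != j, y \in D & below i D y && below j D y].
Proof.
move=> /andP[/= _ /eqP CD] D0; have /set0Pn[t0 t0D] := D0.
pose g l := odflt t0 [pick d in D | below l D d].
have gP l : g l \in D /\ below l D (g l).
  rewrite /g; case: pickP => [d /andP[]//|h].
  by have [d dD ld] := below_min l D0; have := h d; rewrite dD ld.
have : ~~ dinjectiveb g (mem C).
  apply/negP => /dinjectiveP/card_in_imset gC.
  have : g @: C \subset D by apply/subsetP => _ /imsetP[l _ ->]; exact: (gP l).1.
  by move=> /subset_leq_card; rewrite gC CD ltnn.
move=> /dinjectivePn[i iC [j]]; rewrite !inE => /andP[ji jC] gij.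
exists i, j, (g i); split => //; rewrite ?(gP i).1//; first by rewrite eq_sym.
by rewrite (gP i).2 gij (gP j).2.
Qed.

Lemma door_covers_pair D C i j y k : door (D, C) ->
  i \in C -> j \in C -> i != j -> y \in D -> below i D y -> below j D y ->
  k \in C -> covers D (C :\ k) -> (k == i) || (k == j).
Proof.
move=> /andP[/= _ /eqP CD] iC jC ij yD iy jy kC cov.
apply: contraT; rewrite negb_or => /andP[ki kj].
suff /covers_card : covers D (C :\ k :\ j).
  have := cardsD1 j (C :\ k); have := cardsD1 k C.
  by rewrite kC !inE jC eq_sym kj; lia.
move=> e eD; have [l] := cov e eD; rewrite !inE => /andP[lk lC] le.
have [lj|lj] := eqVneq l j; last by exists l; rewrite // !inE lj lk lC.
exists i; first by rewrite !inE ij iC eq_sym ki.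
by rewrite (_ : e = y)//; apply: (@below_uniq j D) => //; rewrite -lj.
Qed.

(** The cells obtained from a door by crossing it on the side of the index [k]:
    either [k] is dropped, or a new point takes over as its minimum. *)
Definition side (d : {set T} * {set I}) k (s : {set T} * {set I}) :=
  s = (d.1, d.2 :\ k) \/
  exists y, [/\ y \notin d.1, s = (y |: d.1, d.2) & below k (y |: d.1) y].

(** The points that would violate dominance if the order [k] were dropped. *)
Definition candidates D C k :=
  [set t | [forall l in C, (l != k) ==> ~~ below l D t]].

Lemma candidatesP D C k t :
  reflect (forall l, l \in C -> l != k -> ~~ below l D t) (t \in candidates D C k).
Proof.
rewrite inE; apply: (iffP forall_inP) => h l lC.
  by move=> lk; have := h l lC; rewrite lk.
by apply/implyP => lk; exact: h.
Qed.

Lemma belowU1 k D y t :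
  below k (y |: D) t = (r k t <= r k y) && below k D t.
Proof.
apply/belowP/andP => [h|[ty /belowP tD] d].
  split; first by apply: h; rewrite setU11.
  by apply/belowP => d dD; apply: h; rewrite setU1r.
by rewrite !inE => /orP[/eqP->//|]; exact: tD.
Qed.

(** If there are candidates, the largest of them in the order [k] can be added:
    it lies below the minimum in the order [k] and leaves the other minima in
    place. *)
Lemma side_ex D C k : door (D, C) -> k \in C -> covers D (C :\ k) ->
  exists s, cell s /\ side (D, C) k s.
Proof.
move=> /andP[/= /dominantP dom /eqP CD] kC cov.
have [M0|[t0 t0M]] := set_0Vmem (candidates D C k).
  exists (D, C :\ k); split; last by left.
  apply/andP; split => /=; last by have := cardsD1 k C; rewrite kC; lia.
  apply/dominantP => t; have : t \notin candidates D C k by rewrite M0 inE.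
  rewrite inE negb_forall_in => /exists_inP[l lC].
  by rewrite negb_imply negbK => /andP[lk lt]; exists l; rewrite // !inE lk.
case: (@arg_maxnP _ t0 (mem (candidates D C k)) (r k) t0M) => y yM ymax.
have kD t : t \in candidates D C k -> below k D t.
  move=> /candidatesP tM; have [l lC lt] := dom t.
  by have [<-//|lk] := eqVneq l k; have := tM l lC lk; rewrite lt.
have yD : y \notin D.
  apply/negP => /cov[l]; rewrite !inE => /andP[lk lC] ly.
  by have /candidatesP/(_ l lC lk) := yM; rewrite ly.
exists (y |: D, C); split; last first.
  by right; exists y; split => //=; rewrite belowU1 leqnn kD.
apply/andP; split => /=; last by rewrite cardsU1 yD CD.
apply/dominantP => t; have [tM|] := boolP (t \in candidates D C k).
  by exists k => //; rewrite belowU1 kD// andbT; exact: ymax.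
rewrite inE negb_forall_in => /exists_inP[l lC].
rewrite negb_imply negbK => /andP[lk lt]; exists l; rewrite // belowU1 lt andbT.
have /candidatesP/(_ l lC lk) := yM; rewrite negb_forall_in => /exists_inP[d dD].
by rewrite -ltnNge => /ltnW; apply: leq_trans; have /belowP := lt; exact.
Qed.

Lemma side_uniq D C k s s' : door (D, C) -> k \in C ->
  cell s -> cell s' -> side (D, C) k s -> side (D, C) k s' -> s = s'.
Proof.
move=> dDC kC.
have candy y : cell (y |: D, C) -> below k (y |: D) y -> y \in candidates D C k.
  move=> cy ky; apply/candidatesP => l lC lk; apply/negP => ly.
  move/eqP: lk; apply; apply: (cell_min_inj cy lC kC (setU11 _ _)) => //.
  by rewrite belowU1 leqnn.
have no_cand y : cell (D, C :\ k) -> y \in candidates D C k -> False.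
  move=> /andP[/dominantP/(_ y)[l lCk ly] _] /candidatesP/(_ l).
  by move: lCk; rewrite !inE => /andP[lk lC] /(_ lC lk); rewrite ly.
have le y y' : cell (y |: D, C) -> y' \in candidates D C k -> r k y' <= r k y.
  move=> /andP[/dominantP/(_ y')[l /= lC] + _] /candidatesP y'M.
  rewrite belowU1 => /andP[ly' lD]; have [<-//|lk] := eqVneq l k.
  by have := y'M l lC lk; rewrite lD.
move=> + + sk sk'; move: sk sk'; rewrite /side /=.
move=> [->|[y [yD -> ky]]] [->|[y' [y'D -> ky']]] cs cs' //.
- by case: (no_cand y') => //; exact: candy.
- by case: (no_cand y) => //; exact: candy.
- suff -> : y = y' by [].
  by apply: (@r_inj k); apply/eqP; rewrite eqn_leq !le//; apply: candy.
Qed.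

Lemma incident_cases D C s : door (D, C) -> cell s -> incident (D, C) s ->
  (exists2 k, k \in C & s = (D, C :\ k)) \/
  (exists2 y, y \notin D & s = (y |: D, C)).
Proof.
case: s => D' C' /andP[/= _ /eqP CD] /andP[/= _ /eqP D'C'] /andP[/= DD CC].
have := subset_leq_card DD; have := subset_leq_card CC.
rewrite CD => le1 le2; have [DE|Dlt] := leqP #|D'| #|D|.
  left; have ED : D = D' by apply/eqP; rewrite eqEcard DD.
  have : C' \proper C by rewrite properEcard CC CD; lia.
  move=> /properP[_ [k kC kC']]; exists k => //; congr (_, _) => //.
  apply/eqP; rewrite eqEcard subsetD1 CC kC'/=.
  by have := cardsD1 k C; rewrite kC; lia.
right; have EC : C' = C by apply/eqP; rewrite eqEcard CC; lia.
have : D \proper D' by rewrite properEcard DD.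
move=> /properP[_ [y yD' yD]]; exists y => //; rewrite EC; congr (_, _).
apply/esym/eqP; rewrite eqEcard finset.subUset finset.sub1set yD' DD/= cardsU1 yD; lia.
Qed.

Lemma side_incident d k s : side d k s -> incident d s.
Proof.
move=> [->|[y [_ -> _]]]; rewrite /incident /= ?subxx ?finset.subsetUr//.
by rewrite subD1set.
Qed.

(** Like an inner facet of a triangulation, a nonempty door separates exactly
    two cells, one on each of its two sides. *)
Lemma door_cells d : door d -> d.1 != set0 ->
  #|[set s | cell s && incident d s]| = 2.
Proof.
case: d => D C dd /= D0; have [i [j [y [iC jC ij yD /andP[iy jy]]]]] := door_pair dd D0.
have /andP[/= dom /eqP CD] := dd.
have cov k k' : (k == i) && (k' == j) || (k == j) && (k' == i) -> covers D (C :\ k).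
  move=> kk' e eD; have [l lC le] := dominant_covers dom eD.
  have [lk|lk] := eqVneq l k; last by exists l; rewrite // !inE lk.
  have ey : e = y.
    by apply: (@below_uniq k D); rewrite -?lk//; case/orP: kk' => /andP[/eqP kE _]; rewrite lk kE.
  exists k'; last by rewrite ey; case/orP: kk' => /andP[_ /eqP ->].
  by rewrite !inE; case/orP: kk' => /andP[/eqP -> /eqP ->]; rewrite ?iC ?jC ?ij// eq_sym ij.
have [si [ci sdi]] := side_ex dd iC (cov i j ltac:(by rewrite !eqxx)).
have [sj [cj sdj]] := side_ex dd jC (cov j i ltac:(by rewrite !eqxx orbT)).
have sij : si != sj.
  apply/eqP => E; rewrite -{}E in cj sdj.
  move: sdi sdj ci; rewrite /side /=.
  move=> [->|[z [zD -> iz]]] [E'|[z' [z'D E' jz']]] ci.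
  - case: E' => /setP/(_ i); rewrite !inE eqxx iC ij//.
  - by case: E' => /setP/(_ z'); rewrite setU11 (negbTE z'D).
  - by case: E' => /setP/(_ z); rewrite setU11 (negbTE zD).
  - have zz : z = z'.
      case: E' => /setP/(_ z); rewrite !inE eqxx/= (negbTE zD) orbF.
      by move=> /esym/eqP.
    move/eqP: ij; apply; subst z'.
    exact: (cell_min_inj ci iC jC (setU11 _ _)).
suff -> : [set s | cell s && incident (D, C) s] = [set si; sj] by rewrite cards2 sij.
apply/setP => s; rewrite !inE; apply/andP/orP => [[cs inc]|]; last first.
  by move=> [/eqP->|/eqP->]; split => //; [exact: side_incident sdi|exact: side_incident sdj].
suff [k kij ks] : exists2 k, (k == i) || (k == j) & side (D, C) k s.
  by case/orP: kij ks => /eqP-> ks; [left|right]; apply/eqP; apply: (side_uniq dd) ks _.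
have [[k kC sE]|[z zD sE]] := incident_cases dd cs inc; subst s.
  exists k; last by left.
  apply: (door_covers_pair dd iC jC ij yD iy jy kC).
  by case/andP: cs => /dominant_covers.
have /andP[/dominant_covers/(_ z (setU11 _ _))[k /= kC kz] _] := cs.
exists k; last by right; exists z.
apply: contraT; rewrite negb_or => /andP[ki kj].
have yz l : l \in C -> l != k -> below l D y -> below l (z |: D) y.
  move=> lC lk ly; rewrite belowU1 ly andbT.
  have : ~~ below l (z |: D) z.
    apply/negP => lz; move/eqP: lk; apply.
    exact: (cell_min_inj cs lC kC (setU11 _ _)).
  rewrite belowU1 leqnn/= negb_forall_in => /exists_inP[d dD].
  by rewrite -ltnNge => /ltnW; apply: leq_trans; have /belowP := ly; exact.
move/eqP: ij; case; apply: (cell_min_inj cs iC jC (setU1r _ yD)).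
  by apply: yz; rewrite // eq_sym.
by apply: yz; rewrite // eq_sym.
Qed.

(** Doors without points form the boundary. *)
Lemma outer_door_cells i (t0 : T) :
  #|[set s | cell s && incident (set0, [set i]) s]| = 1.
Proof.
case: (@arg_maxnP _ t0 predT (r i) isT) => x _ xmax'.
have xmax t : r i t <= r i x by exact: xmax'.
suff -> : [set s | cell s && incident (set0, [set i]) s] = [set ([set x], [set i])].
  by rewrite cards1.
apply/setP => -[D C]; rewrite !inE; apply/andP/eqP => [[/andP[/= dom /eqP DC]]|[-> ->]].
  move=> /andP[/= _]; rewrite subset1 => /orP[/eqP Ci|/eqP C0]; last first.
    by move/dominantP: dom => /(_ t0)[l]; rewrite C0 inE.
  have /cards1P[y Dy] : #|D| == 1 by rewrite DC Ci cards1.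
  rewrite Ci Dy; congr ([set _], _); apply: (@r_inj i); apply/eqP.
  rewrite eqn_leq xmax//=; move/dominantP: dom => /(_ x)[l].
  by rewrite Ci inE => /eqP-> /belowP; apply; rewrite Dy set11.
rewrite /cell /incident /= !cards1 eqxx finset.sub0set subxx andbT; split => //.
apply/dominantP => t; exists i; first exact: set11.
by apply/belowP => d /set1P ->; exact: xmax.
Qed.

Variables (c : T -> I) (i0 : I).

Definition good_door (d : {set T} * {set I}) :=
  [&& door d, i0 \in d.2 & c @: d.1 == d.2 :\ i0].

(** If the labels of the cell are [C :\ i0], two points share a label and
    removing either of them gives a good door.  Otherwise one point [x] has a
    label outside [C], and the good doors are obtained by removing [x] or by
    adding its label to [C]. *)
Lemma cell_good_doors s : cell s -> c @: s.1 != s.2 ->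
  ~~ odd #|[set d | good_door d && incident d s]|.
Proof.
case: s => D C cs /= cDC; have /andP[/= dom /eqP DC] := cs.
have [->|[[D1 C1]]] := set_0Vmem [set d | good_door d && incident d (D, C)].
  by rewrite cards0.
rewrite inE => /andP[/and3P[dd i01 /eqP /= cD1] inc].
have doorx x : x \in D -> door (D :\ x, C).
  move=> xD; apply/andP; split => /=.
    by apply: dominantW dom; rewrite ?subD1set.
  by rewrite -DC (cardsD1 x D) xD.
have doorj j : j \notin C -> door (D, j |: C).
  move=> jC; apply/andP; split => /=.
    by apply: dominantW dom; rewrite ?finset.subsetUr.
  by rewrite DC cardsU1 jC.
have goodx x : x \in D -> good_door (D :\ x, C) = (i0 \in C) && (c @: (D :\ x) == C :\ i0).
  by move=> xD; rewrite /good_door doorx.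
have goodj j : j \notin C ->
    good_door (D, j |: C) = (i0 \in j |: C) && (c @: D == (j |: C) :\ i0).
  by move=> jC; rewrite /good_door doorj.
have shape d : good_door d -> incident d (D, C) ->
    (exists2 x, x \in D & d = (D :\ x, C)) \/ (exists2 j, j \notin C & d = (D, j |: C)).
  case: d => D' C' /and3P[d' _ _] inc'.
  have [[k kC' [-> ->]]|[y yD' [-> ->]]] := incident_cases d' cs inc'.
    by right; exists k; rewrite ?finset.setD1K// !inE eqxx.
  by left; exists y; rewrite ?setU11// finset.setU1K.
suff [x [xD i0C cx cxi]] : exists x, [/\ x \in D, i0 \in C,
    c @: (D :\ x) = C :\ i0 & c x != i0].
  have cDx : c @: D = c x |: (C :\ i0) by rewrite -(finset.setD1K xD) imsetU1 cx.
  have card1 : #|D :\ x| = #|C :\ i0|.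
    by have := cardsD1 x D; have := cardsD1 i0 C; rewrite xD i0C; lia.
  have xinj : {in D :\ x &, injective c} by apply/imset_injP; rewrite cx card1.
  have [cxC|cxC] := boolP (c x \in C).
    have : c x \in c @: (D :\ x) by rewrite cx !inE cxi.
    move=> /imsetP[x' x'Dx cxx']; have := x'Dx; rewrite !inE => /andP[x'x x'D].
    have cDC' : c @: D = C :\ i0.
      by rewrite cDx; apply/finset.setUidPr; rewrite finset.sub1set !inE cxi.
    suff -> : [set d | good_door d && incident d (D, C)] = [set (D :\ x, C); (D :\ x', C)].
      rewrite cards2 (_ : _ != _)//; apply/eqP => -[/setP/(_ x)].
      by rewrite !inE eqxx xD eq_sym x'x.
    apply/setP => d; rewrite !inE; apply/andP/orP.
      move=> [gd id]; case: (shape d gd id) => [[z zD dE]|[j jC dE]]; subst d; last first.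
        move: gd; rewrite goodj// => /andP[_ /eqP E].
        have : j \in c @: D.
          rewrite E !inE eqxx/= andbT; apply: contraNneq jC => ->.
          exact: i0C.
        by rewrite cDC' !inE (negbTE jC) andbF.
      move: gd; rewrite goodx// => /andP[_ /eqP E].
      have [->|zx] := eqVneq z x; first by left; apply/eqP.
      have [->|zx'] := eqVneq z x'; first by right; apply/eqP.
      have : c z \in c @: (D :\ z).
        rewrite E; rewrite -cDC'; exact: imset_f.
      move=> /imsetP[w]; rewrite !inE => /andP[wz wD] czw.
      have zDx : z \in D :\ x by rewrite !inE zx.
      have [wx|wx] := eqVneq w x.
        have := xinj z x' zDx x'Dx; rewrite czw wx cxx' => /(_ erefl) zx''.
        by rewrite zx'' eqxx in zx'.
      have := xinj z w zDx; rewrite !inE wx wD => /(_ isT czw) zw.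
      by rewrite zw eqxx in wz.
    have incx z : incident (D :\ z, C) (D, C) by rewrite /incident/= subD1set subxx.
    move=> [/eqP->|/eqP->]; split => //; rewrite goodx// i0C/= ?cx//.
    rewrite -cDC'; apply/eqP/setP => l; apply/imsetP/imsetP => -[z].
      by rewrite !inE => /andP[_ zD] ->; exists z.
    move=> zD ->; have [->|zx'] := eqVneq z x'.
      by exists x => //; rewrite !inE eq_sym x'x.
    by exists z; rewrite // !inE zx'.
  suff -> : [set d | good_door d && incident d (D, C)] = [set (D :\ x, C); (D, c x |: C)].
    rewrite cards2 (_ : _ != _)//; apply/eqP => -[/setP/(_ x)].
    by rewrite !inE eqxx xD.
  have cDj : c @: D = (c x |: C) :\ i0.
    rewrite cDx; apply/setP => l; rewrite !inE; case: eqP => //= ->.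
    by rewrite cxi.
  apply/setP => d; rewrite !inE; apply/andP/orP.
    move=> [gd id]; case: (shape d gd id) => [[z zD dE]|[j jC dE]]; subst d.
      move: gd; rewrite goodx// => /andP[_ /eqP E].
      have [->|zx] := eqVneq z x; first by left; apply/eqP.
      have : c x \in c @: (D :\ z) by apply: imset_f; rewrite !inE eq_sym zx.
      by rewrite E !inE (negbTE cxC) andbF.
    move: gd; rewrite goodj// => /andP[_ /eqP E].
    right; apply/eqP; congr (_, _ |: _).
    have : c x \in c @: D by exact: imset_f.
    by rewrite E !inE (negbTE cxC) orbF => /andP[_ /eqP ->].
  move=> [/eqP->|/eqP->]; split.
  - by rewrite goodx// i0C cx eqxx.
  - by rewrite /incident/= subD1set subxx.
  - by rewrite goodj// !inE i0C orbT/= cDj.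
  - by rewrite /incident/= subxx finset.subsetUr.
have [gd|//] := boolP (good_door (D1, C1)); last by rewrite /good_door dd i01 /= cD1 eqxx.
case: (shape _ gd inc) => [[x xD [D1E C1E]]|[j jC [D1E C1E]]]; subst D1 C1.
  exists x; split => //; apply: contraNneq cDC => cxi.
  by rewrite -(finset.setD1K xD) imsetU1 cD1 cxi finset.setD1K.
have i0C : i0 \in C.
  move: i01; rewrite !inE => /orP[/eqP i0j|//].
  by move: cDC; rewrite cD1 i0j finset.setU1K// eqxx.
have ji0 : j != i0 by apply: contraNneq jC => ->.
have : j \in c @: D by rewrite cD1 !inE eqxx ji0.
move=> /imsetP[x xD jx]; exists x; split; rewrite -?jx//.
have cinj : {in D &, injective c}.
  apply/imset_injP; rewrite cD1 DC.
  have := cardsU1 j C; have := cardsD1 i0 (j |: C).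
  by rewrite jC !inE i0C orbT; lia.
apply/setP => l; apply/imsetP/idP => [[z]|].
  rewrite !inE => /andP[zx zD] ->; have : c z \in c @: D by exact: imset_f.
  rewrite cD1 !inE => /andP[-> /orP[/eqP czj|//]].
  by move: zx; rewrite (cinj z x)// ?czj ?eqxx.
rewrite !inE => /andP[li0 lC].
have : l \in c @: D by rewrite cD1 !inE li0 lC orbT.
move=> /imsetP[z zD lz]; exists z => //; rewrite !inE zD andbT.
by apply: contraNneq jC => zx; rewrite jx -zx -lz.
Qed.

Lemma even_sum (J : finType) (P : pred J) (f : J -> nat) :
  (forall x, P x -> ~~ odd (f x)) -> ~~ odd (\sum_(x | P x) f x).
Proof.
move=> h; elim/big_ind: _ => // a b; by rewrite oddD => /negbTE-> /negbTE->.
Qed.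

(** Count the incident pairs of a good door and a cell modulo two.  Every good
    door lies in two cells except the outer one, which lies in one; a cell that
    is not fully labelled has an even number of good doors.  So there is a fully
    labelled cell. *)
Theorem scarf (t0 : T) : exists s, cell s /\ c @: s.1 = s.2.
Proof.
apply: contrapT => nfull.
have evR : ~~ odd (\sum_(s | cell s) #|[set d | good_door d && incident d s]|).
  apply: even_sum => s cs; apply: cell_good_doors => //.
  by apply/eqP => E; apply: nfull; exists s.
move: evR; suff -> : \sum_(s | cell s) #|[set d | good_door d && incident d s]| =
    \sum_(d | good_door d) #|[set s | cell s && incident d s]|.
  have go : good_door (set0, [set i0]).
    rewrite /good_door /door /= cards0 cards1 set11 imset0 eqxx andbT /=.
    apply/andP; split; last by rewrite finset.setDv.
    by apply/dominantP => t; exists i0; rewrite ?set11//; apply/belowP => d; rewrite inE.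
  rewrite (bigD1 _ go)/= oddD outer_door_cells//= negbK.
  apply/negP; apply: even_sum => d /andP[gd d0].
  have /and3P[dd i0d /eqP cd] := gd.
  rewrite door_cells//; apply: contraNneq d0 => d10.
  move: cd; rewrite d10 imset0 => /esym E.
  by case: d d10 E {gd dd} i0d => D C /= -> E i0C; rewrite -(finset.setD1K i0C) E finset.setU0.
have cardE (J : finType) (P Q : pred J) :
    #|[set x | P x && Q x]| = \sum_(x | P x) (Q x : nat).
  by rewrite -sum1dep_card big_mkcondr; apply: eq_bigr => x _; case: (Q x).
rewrite (eq_bigr _ (fun s _ => cardE _ good_door (fun d => incident d s))).
rewrite exchange_big /=; apply: eq_bigr => d _.
by rewrite (cardE _ cell (incident d)).
Qed.
End Scarf.

(** * Labelled grids in a simplex *)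

(** Order the grid by its coordinates.  A grid point exceeding by one all the
    minima of a dominant pair cannot exist, so these minima sum up to almost
    [m]; this leaves little room for the points of the pair to differ from each
    other or to move away from the face spanned by [S]. *)
Lemma grid_scarf N m (c : ('I_N.+1 -> nat) -> 'I_N.+1) :
  exists (p : 'I_N.+1 -> 'I_N.+1 -> nat) (S : {set 'I_N.+1}),
  [/\ forall i, \sum_a p i a = m,
      forall i, c (p i) \in S /\ (i \in S -> c (p i) = i),
      forall i j a, p i a <= p j a + N.+1
    & forall i a, a \notin S -> p i a <= N.+1].
Proof.
pose G := {x : {ffun 'I_N.+1 -> 'I_m.+1} | \sum_a x a == m :> nat}.
pose v (x : G) (a : 'I_N.+1) : nat := val x a.
have v_sum x : \sum_a v x a = m by apply/eqP; exact: (valP x).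
have mkG (t : 'I_N.+1 -> nat) : \sum_a t a = m -> exists x : G, forall a, v x a = t a.
  move=> tm; have ta a : t a < m.+1 by rewrite ltnS -tm (bigD1 a)//= leq_addr.
  have hx : \sum_a [ffun a => Ordinal (ta a)] a == m.
    by apply/eqP; rewrite -[RHS]tm; apply: eq_bigr => a _; rewrite ffunE.
  exists (exist (fun x : {ffun 'I_N.+1 -> 'I_m.+1} => \sum_a x a == m :> nat) _ hx).
  by move=> a; rewrite /v /= ffunE.
have [t0 _] : exists x : G, forall a, v x a = (a == ord0) * m.
  by apply: mkG; rewrite (bigD1 ord0)//= mul1n big1 ?addn0// => a /negbTE ->.
(* The rank of the point itself breaks ties between equal coordinates. *)
pose r (i : 'I_N.+1) (x : G) := v x i * #|{: G}| + enum_rank x.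
have rlt (x : G) : enum_rank x < #|{: G}| by [].
have r_inj i : injective (r i).
  move=> x y; rewrite /r => h; apply/enum_rank_inj/val_inj.
  have := congr1 (modn^~ #|{: G}|) h.
  by rewrite /= !modnMDl !modn_small.
have r_le i x y : r i x <= r i y -> v x i <= v y i.
  rewrite /r => h; rewrite leqNgt; apply/negP => yx.
  have := rlt y; have : (v y i).+1 * #|{: G}| <= v x i * #|{: G}| by rewrite leq_mul2r yx orbT.
  by rewrite mulSn; lia.
have [[D C] [/andP[/= dom /eqP DC] /= cD]] := scarf r_inj (fun x => c (v x)) ord0 t0.
have [i1 i1C _] : exists2 i, i \in C & below r i D t0 by move/dominantP: dom; exact.
have [d0 d0D] : exists d, d \in D.
  by apply/card_gt0P; rewrite DC; apply/card_gt0P; exists i1.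
have D0 : D != finset.set0 by apply/finset.set0Pn; exists d0.
have /choice[mu muP] i : exists mu : nat,
    (forall d, d \in D -> mu <= v d i) /\ (forall t, below r i D t -> v t i <= mu).
  have [d dD /belowP db] := below_min r i D0.
  exists (v d i); split => [e eD|t /belowP tb]; apply: r_le; [exact: db|exact: tb].
have key : m < \sum_(a in C) (mu a).+1.
  rewrite ltnNge; apply/negP => hm; pose s := \sum_(a in C) (mu a).+1.
  (* The excess of [m] is put on the coordinate [i1]. *)
  have [t tE] : exists x : G, forall a,
      v x a = (a \in C) * (mu a).+1 + (a == i1) * (m - s).
    apply: mkG; rewrite big_split/= [X in _ + X](bigD1 i1)//= eqxx mul1n.
    rewrite [X in _ + (_ + X)]big1 ?addn0 => [|a /negbTE->//].
    rewrite (_ : \sum_(i < N.+1) (i \in C) * (mu i).+1 = s) ?subnKC//.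
    by rewrite /s [RHS]big_mkcond/=; apply: eq_bigr => a _; case: (a \in C); rewrite ?mul1n.
  move/dominantP: dom => /(_ t)[i iC /(muP i).2]; rewrite tE iC; lia.
have near d a : d \in D -> (a \in C) * mu a <= v d a <= (a \in C) * mu a + N.
  move=> dD; have lo b : (b \in C) * mu b <= v d b.
    by case: (b \in C); rewrite ?mul0n// mul1n (muP b).1.
  rewrite lo /= -leq_subLR; apply: leq_trans (_ : \sum_b (v d b - (b \in C) * mu b) <= _).
    by rewrite [leqRHS](bigD1 a)//= leq_addr.
  have : \sum_b (v d b - (b \in C) * mu b) + \sum_b (b \in C) * mu b = m.
    by rewrite -(v_sum d) -big_split/=; apply: eq_bigr => b _; rewrite subnK.
  have -> : \sum_b (b \in C) * mu b = \sum_(b in C) mu b.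
    by rewrite [RHS]big_mkcond/=; apply: eq_bigr => b _; case: (b \in C); rewrite ?mul1n.
  move: key; under eq_bigr do rewrite -addn1.
  rewrite big_split/= sum1_card.
  have : #|C| <= N.+1 by rewrite -[X in _ <= X]card_ord max_card.
  lia.
have /choice[q qP] i : exists x, x \in D /\ (i \in C -> c (v x) = i).
  have [iC|iC] := boolP (i \in C); last by exists d0.
  by move: iC; rewrite -cD => /imsetP[d dD ->]; exists d.
exists (fun i => v (q i)), C; split => [i|i|i j a|i a aC].
- exact: v_sum.
- split; last exact: (qP i).2.
  by rewrite -cD; apply/imsetP; exists (q i) => //; exact: (qP i).1.
- have /andP[_] := near (q i) a (qP i).1; have /andP[] := near (q j) a (qP j).1; lia.
- by have /andP[_] := near (q i) a (qP i).1; rewrite (negbTE aC); lia.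
Qed.

Local Open Scope classical_set_scope.
Local Open Scope ring_scope.

(** * Orthogonal and triangular matrices *)

Definition upper_mx (R : realType) n (A : 'M[R]_n) :=
  forall i j : 'I_n, (j < i)%N -> A i j = 0.

Definition hessenberg_mx (R : realType) n (A : 'M[R]_n) :=
  forall i j : 'I_n, (j.+1 < i)%N -> A i j = 0.

Definition orthogonal_mx (R : realType) n (Q : 'M[R]_n) := Q *m Q^T = 1%:M.

Lemma orthogonal_trC (R : realType) n (Q : 'M[R]_n) :
  orthogonal_mx Q -> Q^T *m Q = 1%:M.
Proof. by move/mulmx1C. Qed.

Lemma orthogonal_tr (R : realType) n (Q : 'M[R]_n) :
  orthogonal_mx Q -> orthogonal_mx Q^T.
Proof. by move=> /mulmx1C h; rewrite /orthogonal_mx trmxK. Qed.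

Lemma orthogonal_mul (R : realType) n (P Q : 'M[R]_n) :
  orthogonal_mx P -> orthogonal_mx Q -> orthogonal_mx (P *m Q).
Proof.
rewrite /orthogonal_mx => hP hQ.
by rewrite trmx_mul mulmxA -(mulmxA P) hQ mulmx1.
Qed.

Lemma orthogonal_row (R : realType) n (Q : 'M[R]_n) i j :
  orthogonal_mx Q -> \sum_a Q i a * Q j a = (i == j)%:R.
Proof.
move=> /matrixP/(_ i j); rewrite !mxE => <-.
by apply: eq_bigr => a _; rewrite mxE.
Qed.

Lemma orthogonal_col (R : realType) n (Q : 'M[R]_n) i j :
  orthogonal_mx Q -> \sum_a Q a i * Q a j = (i == j)%:R.
Proof.
move=> /orthogonal_tr/orthogonal_row => /(_ i j) <-.
by apply: eq_bigr => a _; rewrite !mxE.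
Qed.

Lemma orthogonal_le1 (R : realType) n (Q : 'M[R]_n) i a :
  orthogonal_mx Q -> `|Q i a| <= 1.
Proof.
move=> /(orthogonal_row i i); rewrite eqxx mulr1n (bigD1 a)//= => h.
rewrite -(expr_le1 (n := 2)) ?normr_ge0// -normrX ger0_norm ?sqr_ge0// expr2 -h.
by rewrite lerDl sumr_ge0// => b _; rewrite -expr2 sqr_ge0.
Qed.

Definition reflection_mx (R : realType) n (v : 'cV[R]_n) : 'M[R]_n :=
  1%:M - (2 / \sum_i v i ord0 ^+ 2) *: (v *m v^T).

Lemma reflection_mx_tr (R : realType) n (v : 'cV[R]_n) :
  (reflection_mx v)^T = reflection_mx v.
Proof. by rewrite /reflection_mx linearB linearZ/= trmx1 trmx_mul trmxK. Qed.

Lemma reflection_mx_orthogonal (R : realType) n (v : 'cV[R]_n) :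
  orthogonal_mx (reflection_mx v).
Proof.
rewrite /orthogonal_mx reflection_mx_tr /reflection_mx.
set s := \sum_i _; set B := _ *: _.
have BB : B *m B = B + B.
  have svv : v^T *m v = s%:M.
    apply/matrixP => i j; rewrite !ord1 !mxE mulr1n.
    by apply: eq_bigr => k _; rewrite !mxE expr2.
  rewrite /B -scalemxAl -scalemxAr mulmxA -(mulmxA v) svv mul_mx_scalar.
  rewrite -scalemxAl !scalerA -scalerDl; congr (_ *: _).
  have [->|s0] := eqVneq s 0; first by rewrite invr0 !(mulr0, mul0r, addr0).
  by field.
by rewrite mulmxBl !mulmxBr !mul1mx mulmx1 BB opprB addrK addrNK.
Qed.

(** Reflect in the hyperplane orthogonal to [x - |x| e_0]. *)
Lemma householder (R : realType) n (x : 'cV[R]_n.+1) :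
  exists2 H : 'M[R]_n.+1, orthogonal_mx H &
    forall i, i != ord0 -> (H *m x) i ord0 = 0.
Proof.
pose N := \sum_i x i ord0 ^+ 2; pose r := Num.sqrt N.
have rN : r ^+ 2 = N by rewrite sqr_sqrtr// sumr_ge0// => i _; exact: sqr_ge0.
have [v v0 vi] : exists2 v : 'cV[R]_n.+1, v ord0 ord0 = x ord0 ord0 - r &
    forall i, i != ord0 -> v i ord0 = x i ord0.
  exists (x - r *: delta_mx ord0 ord0) => [|i i0]; rewrite !mxE ?mulr1//.
  by rewrite (negbTE i0) mulr0 subr0.
exists (reflection_mx v) => [|i i0]; first exact: reflection_mx_orthogonal.
rewrite mulmxBl mul1mx -scalemxAl -mulmxA !mxE big_ord1 vi// mxE.
set S := \sum_i v i ord0 ^+ 2; set D := \sum_j _.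
pose c := \sum_(j < n.+1 | j != ord0) x j ord0 ^+ 2.
have Nc : r ^+ 2 = x ord0 ord0 ^+ 2 + c by rewrite rN /N (bigD1 ord0).
have Sc : S = (x ord0 ord0 - r) ^+ 2 + c.
  by rewrite /S (bigD1 ord0)//= v0; congr (_ + _); apply: eq_bigr => j /vi ->.
have Dc : D = (x ord0 ord0 - r) * x ord0 ord0 + c.
  rewrite /D (bigD1 ord0)//= mxE v0; congr (_ + _).
  by apply: eq_bigr => j /vi vj; rewrite mxE vj expr2.
have DS : D + D = S by rewrite Dc Sc; move: Nc; lra.
have [S0|S0] := eqVneq S 0; last first.
  have -> : D = S / 2 by lra.
  by rewrite mulrCA mulrA; field.
have /eqP : v i ord0 ^+ 2 = 0.
  have /eqP := S0; rewrite psumr_eq0 => [/allP/(_ i)|k _]; last exact: sqr_ge0.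
  by rewrite mem_index_enum => /(_ isT)/= /eqP.
by rewrite sqrf_eq0 vi// => /eqP ->; rewrite !(mulr0, mul0r) subr0.
Qed.

Lemma qr_factorization (R : realType) n (X : 'M[R]_n) :
  exists2 Q, orthogonal_mx Q & upper_mx (Q^T *m X).
Proof.
elim: n X => [|n IH] X; first by exists 1%:M; [apply/matrixP|]; case.
have [H Ho HX] := householder (col ord0 X).
pose Y : 'M[R]_(1 + n) := H *m X.
have [Q Qo QX] := IH (drsubmx Y).
pose B : 'M[R]_(1 + n) := block_mx 1%:M 0 0 Q.
have Bo : orthogonal_mx B.
  rewrite /orthogonal_mx tr_block_mx !trmx0 trmx1 mulmx_block.
  by rewrite !(mulmx0, mul0mx, mul1mx, addr0, add0r) Qo -scalar_mx_block.
exists (H^T *m B); first exact: orthogonal_mul (orthogonal_tr Ho) Bo.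
have -> : (H^T *m B)^T *m X = B^T *m Y by rewrite trmx_mul trmxK -mulmxA.
have -> : B^T = block_mx 1%:M 0 0 Q^T.
  by rewrite tr_block_mx !trmx0 trmx1.
rewrite -(submxK Y) mulmx_block.
rewrite !(mulmx0, mul0mx, mul1mx, addr0, add0r).
have -> : dlsubmx Y = 0.
  apply/matrixP => i j; rewrite ord1 !mxE.
  have /HX : rshift 1 i != ord0 by [].
  rewrite mxE => h; rewrite -[RHS]h; apply: eq_bigr => k _; rewrite !mxE.
  by congr (_ * X _ _); apply: val_inj.
rewrite mulmx0 => i j.
case: (@split_ordP 1 n i) (@split_ordP 1 n j) => i' -> [] j' ->.
- by case: i' => [[|i'] hi]; case: j' => [[|j'] hj].
- by case: i' => [[|i'] hi].
- move=> _; set Z := Q^T *m _.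
  by apply: etrans (block_mxEdl (ulsubmx Y) (ursubmx Y) 0 Z i' j') _; rewrite mxE.
- set Z := Q^T *m _ => ji.
  by apply: etrans (block_mxEdr (ulsubmx Y) (ursubmx Y) 0 Z i' j') _; exact: QX.
Qed.

(** Row by row, the entries right of the diagonal vanish: once this is known for
    the rows above, the column through the diagonal entry is a multiple of a
    basis vector, and the later columns are orthogonal to it. *)
Lemma orthogonal_upper_diag (R : realType) n (U : 'M[R]_n) :
  orthogonal_mx U -> upper_mx U -> forall i j, i != j -> U i j = 0.
Proof.
move=> Uo Uu.
suff h m (i j : 'I_n) : (i <= m)%N -> (i < j)%N -> U i j = 0.
  move=> i j; case: (ltngtP i j) => [ij _|ij _|/val_inj->]; last by rewrite eqxx.
    exact: (h i).
  exact: Uu.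
elim/ltn_ind: m i j => m IH i j im ij.
have col0 a : a != i -> U a i = 0.
  case: (ltngtP a i) => [ai _|ai _|/val_inj->]; last by rewrite eqxx.
    by apply: (IH a) => //; exact: leq_trans ai im.
  exact: Uu.
have sumE b : \sum_a U a i * U a b = U i i * U i b.
  by rewrite (bigD1 i)//= big1 ?addr0// => a ai; rewrite col0// mul0r.
have := orthogonal_col i i Uo; rewrite sumE eqxx => Uii.
have := orthogonal_col i j Uo; rewrite sumE.
have -> : (i == j) = false by apply/negP => /eqP ijE; rewrite ijE ltnn in ij.
move=> /eqP; rewrite mulf_eq0 => /orP[/eqP U0|/eqP//].
by move: Uii => /eqP; rewrite U0 mul0r mulr1n eq_sym oner_eq0.
Qed.

Lemma sign_mxP (R : realType) n (E : 'M[R]_n) :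
  orthogonal_mx E -> (forall i j, i != j -> E i j = 0) -> sign_mx E.
Proof.
move=> Eo Ed; exists (\row_i E i i) => [i|].
  rewrite mxE; have := orthogonal_col i i Eo.
  rewrite (bigD1 i)//= big1 ?addr0 => [|a ai]; last by rewrite Ed// mul0r.
  by rewrite eqxx mulr1n -expr2 => /eqP; rewrite sqrf_eq1 => /orP[]/eqP; [left|right].
apply/matrixP => i j; rewrite !mxE.
by case: eqVneq => [->|ij]; rewrite ?mulr1n// mulr0n Ed.
Qed.

Lemma sign_mx_sqr (R : realType) n (E : 'M[R]_n) : sign_mx E -> E *m E = 1%:M.
Proof.
case=> e he <-; apply/matrixP => i j; rewrite mul_diag_mx !mxE.
case: (eqVneq i j) => [->|]; rewrite ?mulr0//.
by case: (he j) => ->; rewrite ?mulrNN mulr1.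
Qed.

Lemma sign_mx_tr (R : realType) n (E : 'M[R]_n) : sign_mx E -> E^T = E.
Proof. by case=> e he <-; rewrite tr_diag_mx. Qed.

Lemma sign_mx_orthogonal (R : realType) n (E : 'M[R]_n) :
  sign_mx E -> orthogonal_mx E.
Proof. by move=> hE; rewrite /orthogonal_mx sign_mx_tr// sign_mx_sqr. Qed.

Lemma sign_conjE (R : realType) n (e : 'rV[R]_n) (T : 'M[R]_n) i j :
  (diag_mx e *m T *m diag_mx e) i j = e ord0 i * T i j * e ord0 j.
Proof. by rewrite mul_mx_diag mxE mul_diag_mx mxE. Qed.

(** Only the diagonal entry of [P] meets the entry of [A] to be found once the
    previous columns of [A] are known.  This applies in both directions between
    a tridiagonal matrix and the bidiagonal one of its chart. *)
Lemma hessenberg_transport (R : realType) n (A B P : 'M[R]_n) :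
  upper_mx P -> (forall i, P i i != 0) -> hessenberg_mx B ->
  A *m P = P *m B ->
  hessenberg_mx A /\
  forall i j : 'I_n, i = j.+1 :> nat -> A i j * P j j = P i i * B i j.
Proof.
move=> Pu Pd Bh AP.
have rhs (i j : 'I_n) : (j < i)%N -> (P *m B) i j = P i i * B i j.
  move=> ji; rewrite mxE (bigD1 i)//= big1 ?addr0// => k ki.
  case: (ltnP k i) => [/Pu->|ik]; rewrite ?mul0r//.
  rewrite Bh ?mulr0//; move: ki; rewrite -val_eqE/=; lia.
have lhs (i j : 'I_n) : (forall k : 'I_n, (k < j)%N -> A i k = 0) ->
    (A *m P) i j = A i j * P j j.
  move=> Ak; rewrite mxE (bigD1 j)//= big1 ?addr0// => k kj.
  case: (ltnP k j) => [/Ak->|jk]; rewrite ?mul0r//.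
  by rewrite Pu ?mulr0// ltn_neqAle jk andbT eq_sym.
have Ah : hessenberg_mx A.
  move=> i j; move: {2}(j : nat) (leqnn j) => m.
  elim/ltn_ind: m i j => m IH i j jm ji.
  have Ak (k : 'I_n) : (k < j)%N -> A i k = 0.
    by move=> kj; apply: (IH k) => //; lia.
  have := congr1 (fun M : 'M[R]_n => M i j) AP; rewrite lhs// rhs; last by lia.
  by rewrite Bh// mulr0 => /eqP; rewrite mulf_eq0 (negbTE (Pd j)) orbF => /eqP.
split=> // i j ij; rewrite -lhs; last by move=> k kj; apply: Ah; lia.
by rewrite AP rhs// ij.
Qed.

Lemma upper_unit_diag (R : realType) n (A : 'M[R]_n) :
  upper_mx A -> A \in unitmx -> forall i, A i i != 0.
Proof.
move=> Au; rewrite unitmxE unitfE -det_tr det_trig; last first.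
  by apply/is_trig_mxP => i j ij; rewrite mxE Au.
by rewrite prodf_seq_neq0 => /allP h i; have := h i (mem_index_enum _); rewrite mxE.
Qed.

Lemma orthogonal_unit (R : realType) n (Q : 'M[R]_n) :
  orthogonal_mx Q -> Q \in unitmx.
Proof. by move=> /mulmx1_unit[]. Qed.

Lemma upper_cancel (R : realType) n (A P : 'M[R]_n) :
  upper_mx P -> (forall i, P i i != 0) -> upper_mx (A *m P) -> upper_mx A.
Proof.
move=> Pu Pd APu i j; move: {2}(j : nat) (leqnn j) => m.
elim/ltn_ind: m i j => m IH i j jm ji.
have := APu i j ji; rewrite mxE (bigD1 j)//= big1 ?addr0 => [/eqP|k kj].
  by rewrite mulf_eq0 (negbTE (Pd j)) orbF => /eqP.
case: (ltnP k j) => [kj'|jk].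
  by rewrite (IH k) ?mul0r//; lia.
by rewrite Pu ?mulr0// ltn_neqAle jk andbT eq_sym.
Qed.

(** The product [Q^T Q'] is both orthogonal and upper triangular. *)
Lemma qr_unique (R : realType) n (Q Q' X : 'M[R]_n) :
  orthogonal_mx Q -> orthogonal_mx Q' -> X \in unitmx ->
  upper_mx (Q^T *m X) -> upper_mx (Q'^T *m X) ->
  exists2 E, sign_mx E & Q' = Q *m E.
Proof.
move=> Qo Q'o Xu QX Q'X; exists (Q^T *m Q').
  have Uo := orthogonal_mul (orthogonal_tr Qo) Q'o.
  apply: sign_mxP => //; apply: orthogonal_upper_diag => //.
  apply: (upper_cancel Q'X) => [i|].
    by apply: upper_unit_diag => //; rewrite unitmx_mul unitmx_tr orthogonal_unit.
  by rewrite -mulmxA (mulmxA Q') Q'o mul1mx.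
by rewrite mulmxA Qo mul1mx.
Qed.

(** * Spectral decomposition and bidiagonal charts *)

Definition spectral_mx (R : realType) n (mu : 'I_n -> R) (Q : 'M[R]_n) :=
  Q^T *m diag_mx (\row_i mu i) *m Q.

Lemma spectral_mxE (R : realType) n (mu : 'I_n -> R) (Q : 'M[R]_n) a b :
  spectral_mx mu Q a b = \sum_i mu i * (Q i a * Q i b).
Proof.
rewrite /spectral_mx mxE; apply: eq_bigr => i _.
by rewrite mul_mx_diag !mxE mulrAC mulrC mulrA.
Qed.

Lemma spectral_mx_tr (R : realType) n (mu : 'I_n -> R) (Q : 'M[R]_n) :
  (spectral_mx mu Q)^T = spectral_mx mu Q.
Proof. by rewrite /spectral_mx !trmx_mul trmxK tr_diag_mx mulmxA. Qed.

Lemma mulmx_spectral (R : realType) n (mu : 'I_n -> R) (Q : 'M[R]_n) :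
  orthogonal_mx Q ->
  Q *m spectral_mx mu Q = diag_mx (\row_i mu i) *m Q.
Proof. by move=> Qo; rewrite /spectral_mx !mulmxA Qo mul1mx. Qed.

(** Normalised eigenvectors are orthogonal because the eigenvalues are distinct. *)
Lemma isospectral_spectral (R : realType) n (lam : 'I_n -> R)
    (lam_inj : injective lam) (T : 'M[R]_n) :
  isospectral lam T -> exists2 Q, orthogonal_mx Q & T = spectral_mx lam Q.
Proof.
move=> [Tsym _ spec].
have ev i : exists v : 'rV[R]_n, v *m T = lam i *: v /\ v != 0.
  have : range lam (lam i) by exists i.
  by rewrite -spec => /eigenvalueP[v]; exists v.
have [v hv] := choice ev.
pose nv i := Num.sqrt (\sum_a v i ord0 a ^+ 2).
have nv_neq0 i : nv i != 0.
  rewrite sqrtr_eq0 -ltNge lt_neqAle sumr_ge0 ?andbT => [|a _]; last first.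
    exact: sqr_ge0.
  apply: contra (hv i).2; rewrite eq_sym psumr_eq0 => [/allP h|a _]; last first.
    exact: sqr_ge0.
  apply/eqP/rowP => a; have := h a (mem_index_enum _).
  by rewrite mxE sqrf_eq0 => /eqP.
pose Q : 'M[R]_n := \matrix_(i, a) ((nv i)^-1 * v i ord0 a).
have QT : Q *m T = diag_mx (\row_i lam i) *m Q.
  apply/matrixP => i a; rewrite mul_diag_mx !mxE.
  have := congr1 (fun M : 'rV[R]_n => M ord0 a) (hv i).1; rewrite !mxE => h.
  rewrite mulrCA -h mulr_sumr; apply: eq_bigr => b _.
  by rewrite mxE mulrA.
suff Qo : orthogonal_mx Q.
  by exists Q; rewrite // /spectral_mx -mulmxA -QT mulmxA orthogonal_trC// mul1mx.
apply/matrixP => i j; have [<-|ij] := eqVneq i j.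
  rewrite !mxE eqxx mulr1n.
  have -> : \sum_a Q i a * Q^T a i = (nv i)^-1 ^+ 2 * \sum_a v i ord0 a ^+ 2.
    rewrite mulr_sumr; apply: eq_bigr => a _; rewrite !mxE; ring.
  rewrite -[X in _ * X]sqr_sqrtr; last by rewrite sumr_ge0// => a _; exact: sqr_ge0.
  by rewrite -exprMn mulVf ?expr1n.
have key : diag_mx (\row_i lam i) *m (Q *m Q^T) = (Q *m Q^T) *m diag_mx (\row_i lam i).
  by rewrite mulmxA -QT -mulmxA -[in LHS]Tsym -trmx_mul QT trmx_mul tr_diag_mx mulmxA.
have := congr1 (fun M : 'M[R]_n => M i j) key.
rewrite mul_diag_mx mul_mx_diag !mxE (negbTE ij) mulr0n [RHS]mulrC => /eqP.
rewrite -subr_eq0 -mulrBl mulf_eq0 subr_eq0 (inj_eq lam_inj) (negbTE ij)/=.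
by move=> /eqP.
Qed.

Lemma eigenvalue_spectral (R : realType) n (mu : 'I_n -> R) (Q : 'M[R]_n) :
  orthogonal_mx Q -> [set a | eigenvalue (spectral_mx mu Q) a] = range mu.
Proof.
move=> Qo; apply/seteqP; split => [a /eigenvalueP[v vT v0]|_ [i _ <-]].
  pose w := v *m Q^T.
  have wa : w *m diag_mx (\row_i mu i) = a *: w.
    rewrite /w scalemxAl -vT /spectral_mx -!mulmxA Qo mulmx1.
    by rewrite !mulmxA.
  have w0 : w != 0.
    apply: contra v0 => /eqP w0.
    by rewrite -[v]mulmx1 -(orthogonal_trC Qo) mulmxA -/w w0 mul0mx.
  clearbody w; have /rV0Pn[i wi] := w0.
  exists i => //; have := congr1 (fun M : 'rV[R]_n => M ord0 i) wa.
  by rewrite mul_mx_diag !mxE mulrC => h; apply: (mulIf wi).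
apply/eigenvalueP; exists (row i Q).
  rewrite -row_mul mulmx_spectral//; apply/rowP => a.
  by rewrite mxE mul_diag_mx !mxE.
apply/eqP => /rowP r0; have := orthogonal_row i i Qo; rewrite eqxx mulr1n.
rewrite big1 => [/eqP|a _]; first by rewrite eq_sym oner_eq0.
by have := r0 a; rewrite !mxE => ->; rewrite mul0r.
Qed.

Lemma isospectral_spectral_mx (R : realType) n (lam mu : 'I_n -> R)
    (Q : 'M[R]_n) : range mu = range lam -> orthogonal_mx Q ->
  hessenberg_mx (spectral_mx mu Q) -> isospectral lam (spectral_mx mu Q).
Proof.
move=> mulam Qo Th; split; first exact: spectral_mx_tr.
  move=> i j /orP[ij|/Th//]; rewrite -spectral_mx_tr mxE; exact: Th.
by rewrite eigenvalue_spectral.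
Qed.

Definition bidiag_mx (R : realType) n (mu beta : 'I_n -> R) : 'M[R]_n :=
  \matrix_(i, j) (if i == j then mu j else if i == j.+1 :> nat then beta j else 0).

(** The rows are the left eigenvectors of the bidiagonal matrix, normalised to
    be unit lower triangular. *)
Definition bidiag_eigen_mx (R : realType) n (mu beta : 'I_n -> R) : 'M[R]_n :=
  \matrix_(i, j) ((j <= i)%N%:R *
    \prod_(k < n | (j <= k < i)%N) (beta k / (mu i - mu k))).

Lemma bidiag_eigen_diag (R : realType) n (mu beta : 'I_n -> R) i :
  bidiag_eigen_mx mu beta i i = 1.
Proof. by rewrite mxE leqnn mul1r big_pred0// => k; lia. Qed.

Lemma bidiag_eigen_lower (R : realType) n (mu beta : 'I_n -> R) (i j : 'I_n) :
  (i < j)%N -> bidiag_eigen_mx mu beta i j = 0.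
Proof. by move=> ij; rewrite mxE leqNgt ij mul0r. Qed.

Lemma bidiag_eigen_step (R : realType) n (mu beta : 'I_n -> R) (i j j' : 'I_n) :
  j' = j.+1 :> nat -> (j < i)%N ->
  bidiag_eigen_mx mu beta i j =
  beta j / (mu i - mu j) * bidiag_eigen_mx mu beta i j'.
Proof.
move=> j'E ji; rewrite !mxE j'E ji (ltnW ji) !mul1r (bigD1 j) ?leqnn//=.
congr (_ * _); apply: eq_bigl => k; rewrite -val_eqE/=; lia.
Qed.

Lemma bidiag_eigen_unit (R : realType) n (mu beta : 'I_n -> R) :
  bidiag_eigen_mx mu beta \in unitmx.
Proof.
rewrite unitmxE unitfE det_trig; last first.
  by apply/is_trig_mxP => i j; exact: bidiag_eigen_lower.
by rewrite big1 ?oner_eq0// => i _; rewrite bidiag_eigen_diag.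
Qed.

Lemma bidiag_eigenE (R : realType) n (mu beta : 'I_n -> R) :
  injective mu ->
  diag_mx (\row_i mu i) *m bidiag_eigen_mx mu beta =
  bidiag_eigen_mx mu beta *m bidiag_mx mu beta.
Proof.
move=> mu_inj; apply/matrixP => i j; rewrite mul_diag_mx [LHS]mxE [in LHS]mxE.
rewrite [RHS]mxE (bigD1 j)//= [bidiag_mx _ _ j j]mxE eqxx.
have [jn|jn] := ltnP j.+1 n; last first.
  rewrite big1 ?addr0 => [|k kj]; last first.
    by rewrite [bidiag_mx _ _ _ _]mxE (negbTE kj) ifF ?mulr0//; have := ltn_ord k; lia.
  have [->|ij] := eqVneq i j; first by rewrite mulrC.
  rewrite bidiag_eigen_lower ?mulr0 ?mul0r//.
  by have := ltn_ord i; move: ij; rewrite -val_eqE/=; lia.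
rewrite (bigD1 (Ordinal jn)) -?val_eqE/= ?big1 ?addr0 => [|k kj|]; last by lia.
  rewrite [bidiag_mx _ _ _ _]mxE -val_eqE/= ifF ?eqxx; last by lia.
  case: (ltngtP i j) => [ij|ji|/val_inj ->].
  - by rewrite !bidiag_eigen_lower ?mulr0 ?mul0r ?addr0//=; lia.
  - rewrite (@bidiag_eigen_step _ _ _ _ i j (Ordinal jn))//.
    have : mu i - mu j != 0.
      by rewrite subr_eq0 (inj_eq mu_inj) -val_eqE/=; lia.
    by move=> h; field.
  - by rewrite bidiag_eigen_diag mulr1 mul1r bidiag_eigen_lower ?mul0r ?addr0.
rewrite [bidiag_mx _ _ _ _]mxE !ifF ?mulr0//; move: kj; rewrite -!val_eqE/=; lia.
Qed.

Lemma range_perm (R : realType) n (lam : 'I_n -> R) (s : {perm 'I_n}) :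
  range (lam \o s) = range lam.
Proof.
apply/seteqP; split => [_ [i _ <-]|_ [i _ <-]]; first by exists (s i).
by exists (perm_inv s i) => //=; rewrite permKV.
Qed.

(** The orthogonal factor of a matrix is only determined up to signs, hence a
    relation instead of a function of the parameters. *)
Definition in_chart (R : realType) n (mu beta : 'I_n -> R) (T : 'M[R]_n) :=
  exists Q, [/\ orthogonal_mx Q, upper_mx (Q^T *m bidiag_eigen_mx mu beta)
    & T = spectral_mx mu Q].

Lemma chart_ex (R : realType) n (mu beta : 'I_n -> R) :
  exists T, in_chart mu beta T.
Proof.
have [Q Qo QL] := qr_factorization (bidiag_eigen_mx mu beta).
by exists (spectral_mx mu Q), Q.
Qed.

Lemma bidiag_hessenberg (R : realType) n (mu beta : 'I_n -> R) :
  hessenberg_mx (bidiag_mx mu beta).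
Proof.
move=> i j ij; rewrite mxE ifF; last by rewrite -val_eqE/=; lia.
by rewrite ifF//; lia.
Qed.

Lemma chart_factor (R : realType) n (mu beta : 'I_n -> R) (Q : 'M[R]_n) :
  injective mu -> orthogonal_mx Q ->
  upper_mx (Q^T *m bidiag_eigen_mx mu beta) ->
  let P := Q^T *m bidiag_eigen_mx mu beta in
  [/\ forall i, P i i != 0, hessenberg_mx (spectral_mx mu Q) &
    forall i j : 'I_n, i = j.+1 :> nat ->
      spectral_mx mu Q i j * P j j = P i i * beta j].
Proof.
move=> mu_inj Qo Pu P.
have Pd : forall i, P i i != 0.
  apply: upper_unit_diag => //.
  by rewrite unitmx_mul unitmx_tr orthogonal_unit ?bidiag_eigen_unit.
have [|h1 h2] := @hessenberg_transport _ _ (spectral_mx mu Q)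
    (bidiag_mx mu beta) P Pu Pd (bidiag_hessenberg mu beta).
  rewrite /P /spectral_mx -[RHS]mulmxA -(bidiag_eigenE beta)//.
  by rewrite -!mulmxA (mulmxA Q) Qo mul1mx.
split=> // i j ij; rewrite h2// [bidiag_mx _ _ _ _]mxE ifF; last by rewrite -val_eqE/=; lia.
by rewrite ij eqxx.
Qed.

Lemma chart_isospectral (R : realType) n (lam mu beta : 'I_n -> R)
    (T : 'M[R]_n) : injective mu -> range mu = range lam ->
  in_chart mu beta T -> isospectral lam T.
Proof.
move=> mu_inj mulam [Q [Qo Pu ->]].
have [_ Th _] := chart_factor mu_inj Qo Pu.
exact: isospectral_spectral_mx.
Qed.

Lemma chart_subdiag (R : realType) n (mu beta : 'I_n -> R)
    (T : 'M[R]_n) (i j : 'I_n) : injective mu -> i = j.+1 :> nat ->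
  in_chart mu beta T -> (T i j == 0) = (beta j == 0).
Proof.
move=> mu_inj ij [Q [Qo Pu ->]].
have [Pd _ /(_ i j ij) h] := chart_factor mu_inj Qo Pu.
have := congr1 (fun x => x == 0) h.
by rewrite !mulf_eq0 !(negbTE (Pd _)) orbF.
Qed.

Lemma chart_unique (R : realType) n (mu beta : 'I_n -> R) (T T' : 'M[R]_n) :
  in_chart mu beta T -> in_chart mu beta T' ->
  exists2 E, sign_mx E & T' = E *m T *m E.
Proof.
move=> [Q [Qo Pu ->]] [Q' [Q'o Pu' ->]].
have [E Es ->] := qr_unique Qo Q'o (bidiag_eigen_unit mu beta) Pu Pu'.
exists E => //; rewrite /spectral_mx trmx_mul (sign_mx_tr Es).
by rewrite !mulmxA.
Qed.

Lemma in_chart0 (R : realType) n (mu : 'I_n -> R) :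
  in_chart mu (fun=> 0) (diag_mx (\row_i mu i)).
Proof.
exists 1%:M; split; first by rewrite /orthogonal_mx trmx1 mulmx1.
  rewrite trmx1 mul1mx => i j ji; rewrite mxE (bigD1 j) ?leqnn//=.
  by rewrite mul0r mul0r mulr0.
by rewrite /spectral_mx trmx1 mul1mx mulmx1.
Qed.

(** The eigenvector equation determines each row of [L] from its diagonal entry
    leftwards. *)
Lemma lower_bidiag_eigen (R : realType) n (mu : 'I_n -> R) (L A : 'M[R]_n) :
  injective mu -> upper_mx L^T -> (forall i, L i i = 1) ->
  hessenberg_mx A -> L *m A = diag_mx (\row_i mu i) *m L ->
  exists beta, L = bidiag_eigen_mx mu beta.
Proof.
move=> mu_inj Ll L1 Ah LA.
have Al : upper_mx A^T.
  apply: (@upper_cancel _ _ A^T L^T) => // [i|]; first by rewrite mxE L1 oner_eq0.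
  rewrite -trmx_mul LA => i j ji; rewrite mxE mul_diag_mx mxE.
  by have := Ll i j ji; rewrite mxE => ->; rewrite mulr0.
have {}Ll (i j : 'I_n) : (i < j)%N -> L i j = 0.
  by move=> ij; have := Ll _ _ ij; rewrite mxE.
have {}Al (i j : 'I_n) : (i < j)%N -> A i j = 0.
  by move=> ij; have := Al _ _ ij; rewrite mxE.
have LAE i j : \sum_k L i k * A k j = mu i * L i j.
  by have := congr1 (fun M : 'M[R]_n => M i j) LA; rewrite mul_diag_mx !mxE.
have Ad i : A i i = mu i.
  have := LAE i i; rewrite L1 mulr1 (bigD1 i)//= L1 mul1r big1 ?addr0//.
  move=> k; rewrite -val_eqE/= => ki; case: (ltnP k i) => [/Al->|ik].
    by rewrite mulr0.
  by rewrite Ll ?mul0r//; lia.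
pose beta (j : 'I_n) := if insub j.+1 is Some j' then A j' j else 0.
exists beta; apply/matrixP => i j.
have := leqnn (i - j)%N; move: {2}(i - j)%N => d.
elim: d j => [|d IH] j dij.
  have [ij|ji|/val_inj ->] := ltngtP i j; [|lia|].
    by rewrite Ll// bidiag_eigen_lower.
  by rewrite L1 bidiag_eigen_diag.
have [ij|ij] := leqP i j; first by apply: IH; lia.
have jn : (j.+1 < n)%N by have := ltn_ord i; lia.
have bj : beta j = A (Ordinal jn) j by rewrite /beta insubT.
rewrite (@bidiag_eigen_step _ _ _ _ i j (Ordinal jn))// -IH/=; last by lia.
have := LAE i j; rewrite (bigD1 j)//= (bigD1 (Ordinal jn)) -?val_eqE/=; last by lia.
rewrite big1 ?addr0 => [|k /andP[kj kj1]]; last first.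
  case: (ltnP k j) => [/Al->|jk]; first by rewrite mulr0.
  rewrite Ah ?mulr0//; move: kj kj1; rewrite -!val_eqE/=; lia.
rewrite Ad bj => h.
have h0 : mu i - mu j != 0 by rewrite subr_eq0 (inj_eq mu_inj) -val_eqE/=; lia.
apply: (mulfI h0); rewrite mulrA [X in _ = X * _]mulrC divfK//; lra.
Qed.

(** Write the matrix of eigenvectors as [Q = L U] after exchanging rows.  Then
    [U T U^-1] is Hessenberg, since [U] is triangular, and it equals
    [L^-1 diag L], which is lower triangular; so it is bidiagonal, and [L]
    consists of its eigenvectors. *)
Lemma chart_cover (R : realType) n (lam : 'I_n.+1 -> R)
    (lam_inj : injective lam) (T : 'M[R]_n.+1) : isospectral lam T ->
  exists (s : {perm 'I_n.+1}) (beta : 'I_n.+1 -> R),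
    in_chart (lam \o s) beta T.
Proof.
move=> Tiso; have [Q0 Q0o TQ0] := isospectral_spectral lam_inj Tiso.
have [/is_perm_mxP[s Ps] PQ] := (cormen_lup_perm Q0, cormen_lup_correct Q0).
pose L := (cormen_lup Q0).1.2; pose U := (cormen_lup Q0).2.
have Ll (i j : 'I_n.+1) : (i <= j)%N -> L i j = (i == j)%:R.
  exact: cormen_lup_lower.
have Uu : upper_mx U by move=> i j; exact: cormen_lup_upper.
have {}PQ : perm_mx s *m Q0 = L *m U.
  by rewrite -Ps /L /U; move: PQ; case: cormen_lup => [[]].
pose Q := perm_mx s *m Q0.
have Qo : orthogonal_mx Q.
  apply: orthogonal_mul => //.
  by rewrite /orthogonal_mx tr_perm_mx -perm_mxM mulgV perm_mx1.
have Lt : is_trig_mx L.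
  apply/is_trig_mxP => i j ij; rewrite Ll ?(ltnW ij)//.
  by rewrite (_ : (i == j) = false)// -val_eqE/=; lia.
have L1 i : L i i = 1 by rewrite Ll// eqxx.
have Lunit : L \in unitmx.
  by rewrite unitmxE unitfE det_trig// big1 ?oner_eq0.
have Uunit : U \in unitmx.
  have := orthogonal_unit Qo; rewrite /Q PQ unitmx_mul => /andP[_ //].
have Ud := upper_unit_diag Uu Uunit.
pose mu := lam \o s.
have mu_inj : injective mu by move=> i j /lam_inj/perm_inj.
have TQ : T = spectral_mx mu Q.
  rewrite TQ0; apply/matrixP => a b; rewrite !spectral_mxE.
  rewrite (reindex_inj (@perm_inj _ s)); apply: eq_bigr => i _.
  by rewrite /Q -row_permE !mxE.
have QT := mulmx_spectral mu Qo; rewrite -TQ in QT.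
pose A := invmx L *m diag_mx (\row_i mu i) *m L.
have LA : L *m A = diag_mx (\row_i mu i) *m L by rewrite /A -mulmxA mulKVmx.
have AU : A *m U = U *m T.
  rewrite /A -!mulmxA -PQ -QT /Q PQ -mulmxA mulKmx//.
have [|Ah _] := hessenberg_transport Uu Ud _ AU.
  move=> i j ji; have [_ + _] := Tiso; apply; by rewrite ji orbT.
have [|beta LE] := lower_bidiag_eigen mu_inj _ L1 Ah LA.
  by move=> i j ji; rewrite mxE (is_trig_mxP Lt).
exists s, beta, Q; split => //; rewrite -LE.
apply: (@upper_cancel _ _ _ U) => //.
rewrite -mulmxA -PQ (orthogonal_trC Qo) => i j ji.
by rewrite mxE (_ : (i == j) = false)// -val_eqE/=; lia.
Qed.

(** * Spectral weights *)

Definition lagrange_poly (R : realType) n (lam : 'I_n -> R) (i : 'I_n) : {poly R} :=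
  \prod_(j | j != i) ((lam i - lam j)^-1 *: ('X - (lam j)%:P)).

Lemma lagrange_polyE (R : realType) n (lam : 'I_n -> R) (i k : 'I_n) :
  injective lam -> (lagrange_poly lam i).[lam k] = (k == i)%:R.
Proof.
move=> lam_inj; rewrite horner_prod.
have [->|ki] := eqVneq k i.
  rewrite big1// => j ji; rewrite hornerZ hornerXsubC mulVf//.
  by rewrite subr_eq0 (inj_eq lam_inj) eq_sym.
by rewrite (bigD1 k)//= hornerZ hornerXsubC subrr mulr0 mul0r.
Qed.

(** The squared component along [e_a] of the unit eigenvector of [T] for
    [lam i], as a diagonal entry of the spectral projection: a polynomial in
    [T], hence continuous. *)
Definition weight (R : realType) n (lam : 'I_n.+1 -> R) (i a : 'I_n.+1)
    (T : 'M[R]_n.+1) : R :=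
  horner_mx T (lagrange_poly lam i) a a.

Lemma weight_spectral (R : realType) n (lam : 'I_n.+1 -> R) (i a : 'I_n.+1)
    (Q : 'M[R]_n.+1) : injective lam -> orthogonal_mx Q ->
  weight lam i a (spectral_mx lam Q) = Q i a ^+ 2.
Proof.
move=> lam_inj Qo.
have QV : Q = invmx Q^T.
  have Qu := orthogonal_unit (orthogonal_tr Qo).
  by rewrite -[RHS]mul1mx -Qo mulmxK.
rewrite /weight /spectral_mx {2}QV horner_mx_uconj; last first.
  exact: orthogonal_unit (orthogonal_tr Qo).
rewrite -QV horner_mx_diag mxE (bigD1 i)//= big1 ?addr0 => [|j ji].
  by rewrite mul_mx_diag !mxE lagrange_polyE// eqxx mulr1 expr2.
by rewrite mul_mx_diag !mxE lagrange_polyE// (negbTE ji) mulr0 mul0r.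
Qed.


Lemma weight_ge0 (R : realType) n (lam : 'I_n.+1 -> R) i a T :
  injective lam -> isospectral lam T -> 0 <= weight lam i a T.
Proof.
move=> lam_inj /(isospectral_spectral lam_inj)[Q Qo ->].
by rewrite weight_spectral// sqr_ge0.
Qed.

Lemma weight_sum (R : realType) n (lam : 'I_n.+1 -> R) a T :
  injective lam -> isospectral lam T -> \sum_i weight lam i a T = 1.
Proof.
move=> lam_inj /(isospectral_spectral lam_inj)[Q Qo ->].
have := orthogonal_col a a Qo; rewrite eqxx mulr1n => <-.
by apply: eq_bigr => i _; rewrite weight_spectral// expr2.
Qed.

Lemma weight_total (R : realType) n (lam : 'I_n.+1 -> R) i T :
  injective lam -> isospectral lam T -> \sum_a weight lam i a T = 1.
Proof.
move=> lam_inj /(isospectral_spectral lam_inj)[Q Qo ->].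
have := orthogonal_row i i Qo; rewrite eqxx mulr1n => <-.
by apply: eq_bigr => a _; rewrite weight_spectral// expr2.
Qed.

Lemma isospectral_sign (R : realType) n (lam : 'I_n -> R) (E T : 'M[R]_n) :
  injective lam -> sign_mx E -> isospectral lam T ->
  isospectral lam (E *m T *m E).
Proof.
move=> lam_inj Es Tiso; have [Q Qo TQ] := isospectral_spectral lam_inj Tiso.
have -> : E *m T *m E = spectral_mx lam (Q *m E).
  by rewrite TQ /spectral_mx trmx_mul (sign_mx_tr Es) !mulmxA.
apply: isospectral_spectral_mx => //.
  exact: orthogonal_mul (sign_mx_orthogonal Es).
have -> : spectral_mx lam (Q *m E) = E *m T *m E.
  by rewrite TQ /spectral_mx trmx_mul (sign_mx_tr Es) !mulmxA.
case: Es => e _ <- i j ij; rewrite sign_conjE; have [_ + _] := Tiso => ->.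
  by rewrite mulr0 mul0r.
by rewrite ij orbT.
Qed.

Lemma weight_sign (R : realType) n (lam : 'I_n.+1 -> R) i a (E T : 'M[R]_n.+1) :
  injective lam -> sign_mx E -> isospectral lam T ->
  weight lam i a (E *m T *m E) = weight lam i a T.
Proof.
move=> lam_inj Es /(isospectral_spectral lam_inj)[Q Qo ->].
have -> : E *m spectral_mx lam Q *m E = spectral_mx lam (Q *m E).
  by rewrite /spectral_mx trmx_mul (sign_mx_tr Es) !mulmxA.
rewrite !weight_spectral//; last exact: orthogonal_mul (sign_mx_orthogonal Es).
case: Es => e he <-; rewrite mul_mx_diag mxE exprMn.
by case: (he a) => ->; rewrite ?sqrrN expr1n mulr1.
Qed.

Lemma spectral_eigenvector (R : realType) n (lam : 'I_n -> R) (Q : 'M[R]_n)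
    (i : 'I_n) (v : 'rV[R]_n) : injective lam -> orthogonal_mx Q ->
  v *m spectral_mx lam Q = lam i *: v -> exists c, v = c *: row i Q.
Proof.
move=> lam_inj Qo vT; pose y := v *m Q^T.
have yv : v = y *m Q by rewrite /y -mulmxA (orthogonal_trC Qo) mulmx1.
have yE : y *m diag_mx (\row_i lam i) = lam i *: y.
  by rewrite /y scalemxAl -vT /spectral_mx -!mulmxA Qo mulmx1.
clearbody y; exists (y ord0 i); rewrite yv; apply/rowP => a.
rewrite !mxE (bigD1 i)//= big1 ?addr0 => [//|j ji].
have := congr1 (fun M : 'rV[R]_n => M ord0 j) yE.
rewrite mul_mx_diag !mxE mulrC => /eqP; rewrite -subr_eq0 -mulrBl mulf_eq0.
by rewrite subr_eq0 (inj_eq lam_inj) (negbTE ji)/= => /eqP ->; rewrite mul0r.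
Qed.

Lemma reduced_block (R : realType) n (lam : 'I_n -> R) (k k' : 'I_n)
    (T : 'M[R]_n) : isospectral lam T -> k' = k.+1 :> nat -> T k' k = 0 ->
  forall a b : 'I_n, (a <= k)%N -> (k < b)%N -> T a b = 0 /\ T b a = 0.
Proof.
move=> [Tsym Ttri _] k'k Tk a b ak kb.
suff : T b a = 0 by move=> h; rewrite -{1}Tsym mxE.
have [ab|ab] := ltnP a.+1 b; first by rewrite Ttri// ab orbT.
suff [-> ->] : b = k' /\ a = k by [].
by split; apply: val_inj => /=; lia.
Qed.

(** When the matrix splits into two diagonal blocks, truncating an eigenvector
    to a block yields an eigenvector for the same simple eigenvalue; hence each
    eigenvector lives on a single block. *)
Lemma weight_split (R : realType) n (lam : 'I_n.+1 -> R) (k k' : 'I_n.+1) T i :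
  injective lam -> isospectral lam T -> k' = k.+1 :> nat -> T k' k = 0 ->
  (forall a : 'I_n.+1, (a <= k)%N -> weight lam i a T = 0) \/
  (forall a : 'I_n.+1, (k < a)%N -> weight lam i a T = 0).
Proof.
move=> lam_inj Tiso k'k Tk; have [Q Qo TQ] := isospectral_spectral lam_inj Tiso.
have Tz := reduced_block Tiso k'k Tk.
pose x : 'rV[R]_n.+1 := \row_a (if (a <= k)%N then Q i a else 0).
have xT : x *m spectral_mx lam Q = lam i *: x.
  rewrite -TQ; apply/rowP => a; rewrite !mxE.
  have QT b : \sum_c Q i c * T c b = lam i * Q i b.
    have := congr1 (fun M : 'M[R]_n.+1 => M i b) (mulmx_spectral lam Qo).
    by rewrite -TQ mul_diag_mx !mxE.
  case: (leqP a k) => ak.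
    rewrite -QT; apply: eq_bigr => c _; rewrite mxE.
    by case: (leqP c k) => // kc; rewrite (Tz a c ak kc).2 mul0r mulr0.
  rewrite mulr0 big1// => c _; rewrite mxE; case: (leqP c k) => ck; last by rewrite mul0r.
  by rewrite (Tz c a ck ak).1 mulr0.
have [c xE] := spectral_eigenvector lam_inj Qo xT.
have xa (a : 'I_n.+1) : (if (a <= k)%N then Q i a else 0) = c * Q i a.
  by have := congr1 (fun M : 'rV[R]_n.+1 => M ord0 a) xE; rewrite !mxE.
have [h|/existsNP[a /not_implyP[ak wa]]] :=
    pselect (forall a : 'I_n.+1, (a <= k)%N -> weight lam i a T = 0); first by left.
right => b kb; rewrite TQ weight_spectral//.
have Qa : Q i a != 0.
  by apply/eqP => Qa0; apply: wa; rewrite TQ weight_spectral// Qa0 expr0n.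
have c1 : c = 1.
  by have := xa a; rewrite ak => /esym; rewrite -[RHS]mul1r => /(mulIf Qa).
by have := xa b; rewrite leqNgt kb/= c1 mul1r => <-; rewrite expr0n.
Qed.

Definition unreduced (R : realType) n (T : 'M[R]_n) :=
  forall i j : 'I_n, i = j.+1 :> nat -> T i j != 0.

(** The three-term recurrence determines an eigenvector from its first entry as
    long as the subdiagonal does not vanish. *)
Lemma weight0_recurrence (R : realType) n (lam : 'I_n.+1 -> R) T i (m : nat) :
  injective lam -> isospectral lam T -> weight lam i ord0 T = 0 ->
  (forall k k' : 'I_n.+1, k' = k.+1 :> nat -> (k < m)%N -> T k' k != 0) ->
  forall a : 'I_n.+1, (a <= m)%N -> weight lam i a T = 0.
Proof.
move=> lam_inj Tiso w0 Tm a am; have [Q Qo TQ] := isospectral_spectral lam_inj Tiso.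
suff : Q i a = 0 by rewrite TQ weight_spectral// => ->; rewrite expr0n.
have [Tsym Ttri _] := Tiso.
have Q0 : Q i ord0 = 0.
  by move: w0; rewrite TQ weight_spectral// => /eqP; rewrite sqrf_eq0 => /eqP.
have QT b : \sum_c Q i c * T c b = lam i * Q i b.
  have := congr1 (fun M : 'M[R]_n.+1 => M i b) (mulmx_spectral lam Qo).
  by rewrite -TQ mul_diag_mx !mxE.
move: {2}(a : nat) (leqnn a) => d; elim/ltn_ind: d a am => d IH a am ad.
case: (posnP a) => [a0|a0]; first by rewrite (_ : a = ord0)//; apply: val_inj.
have bn : (a.-1 < n.+1)%N by have := ltn_ord a; lia.
pose b := Ordinal bn.
have ab : a = b.+1 :> nat by rewrite /= prednK.
have Qlt (c : 'I_n.+1) : (c <= b)%N -> Q i c = 0.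
  by move=> cb; apply: (IH c) => //=; lia.
have := QT b; rewrite (Qlt b)// mulr0 (bigD1 a)//= big1 ?addr0 => [/eqP|c ca].
  by rewrite mulf_eq0 (negbTE (Tm b a _ _))//= ?orbF => [/eqP//|]; lia.
have [cb|cb] := leqP c b; first by rewrite Qlt// mul0r.
by rewrite Ttri ?mulr0//; move: ca; rewrite -val_eqE/=; lia.
Qed.

Lemma unreduced_weight (R : realType) n (lam : 'I_n.+1 -> R) T i :
  injective lam -> isospectral lam T -> unreduced T -> 0 < weight lam i ord0 T.
Proof.
move=> lam_inj Tiso Tu; rewrite lt_neqAle weight_ge0// andbT eq_sym.
apply/eqP => w0; have := weight_total i lam_inj Tiso.
rewrite big1 => [/eqP|a _]; first by rewrite eq_sym oner_eq0.
by apply: (weight0_recurrence (m := n) lam_inj Tiso w0) => [k k' /Tu//|]; rewrite -ltnS.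
Qed.

Lemma weight_unreduced (R : realType) n (lam : 'I_n.+1 -> R) T :
  injective lam -> isospectral lam T -> (forall i, 0 < weight lam i ord0 T) ->
  unreduced T.
Proof.
move=> lam_inj Tiso w0 k' k k'k; apply/eqP => Tk.
have := weight_sum k' lam_inj Tiso; rewrite big1 => [/eqP|i _].
  by rewrite eq_sym oner_eq0.
have [h|h] := weight_split i lam_inj Tiso k'k Tk.
  by have := w0 i; rewrite h// ltxx.
by apply: h; rewrite k'k.
Qed.

(** The columns of [U] are obtained from the first one by applying polynomials
    in [T] of increasing degree. *)
Lemma krylov_upper (R : realType) n (T T' U : 'M[R]_n.+1) :
  hessenberg_mx T -> hessenberg_mx T' -> unreduced T' ->
  T *m U = U *m T' -> (forall a, a != ord0 -> U a ord0 = 0) -> upper_mx U.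
Proof.
move=> Th T'h T'u TU U0 a j; move: {2}(j : nat) (leqnn j) => d.
elim/ltn_ind: d a j => d IH a j jd ja.
case: (posnP j) => [j0|j0].
  by rewrite (_ : j = ord0) ?U0//; [rewrite -val_eqE/=; lia|apply: val_inj].
have bn : (j.-1 < n.+1)%N by have := ltn_ord j; lia.
pose b := Ordinal bn.
have jb : j = b.+1 :> nat by rewrite /= prednK.
have Ult (c e : 'I_n.+1) : (c <= b)%N -> (c < e)%N -> U e c = 0.
  by move=> cb ce; apply: (IH c) => //=; lia.
have := congr1 (fun M : 'M[R]_n.+1 => M a b) TU; rewrite !mxE big1 => [|c _].
  rewrite (bigD1 j)//= big1 ?addr0 => [/esym/eqP|c cj].
    by rewrite mulf_eq0 (negbTE (T'u _ _ jb)) orbF => /eqP.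
  have [cb|cb] := leqP c b; first by rewrite Ult ?mul0r//; lia.
  by rewrite T'h ?mulr0//; move: cj; rewrite -val_eqE/=; lia.
have [cb|cb] := leqP c b; last by rewrite Ult// mulr0.
by rewrite Th ?mul0r//; lia.
Qed.

(** After a change of sign of eigenvectors, both eigenvector matrices have the
    same first column.  The orthogonal matrix intertwining [T] and [T'] then
    fixes the first basis vector, so it is upper triangular, hence diagonal. *)
Lemma weight_inj (R : realType) n (lam : 'I_n.+1 -> R) (T T' : 'M[R]_n.+1) :
  injective lam -> isospectral lam T -> isospectral lam T' -> unreduced T' ->
  (forall i, weight lam i ord0 T = weight lam i ord0 T') ->
  exists2 E, sign_mx E & T' = E *m T *m E.
Proof.
move=> lam_inj Tiso Tiso' T'u ww.
have [Q Qo TQ] := isospectral_spectral lam_inj Tiso.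
have [Q' Qo' TQ'] := isospectral_spectral lam_inj Tiso'.
pose d i : R := if Q i ord0 == Q' i ord0 then 1 else -1.
have d2 i : d i * d i = 1 by rewrite /d; case: ifP; rewrite ?mulrNN mulr1.
have dQ i : d i * Q i ord0 = Q' i ord0.
  have := ww i; rewrite TQ TQ' !weight_spectral// => /eqP; rewrite eqf_sqr /d.
  by case: eqP => [->|_ /= /eqP ->]; rewrite ?mul1r// mulN1r opprK.
pose D := diag_mx (\row_i d i).
have Ds : sign_mx D.
  exists (\row_i d i) => // i; rewrite mxE /d.
  by case: ifP; [left|right].
pose Q1 := D *m Q.
have Q1o : orthogonal_mx Q1 by apply: orthogonal_mul => //; exact: sign_mx_orthogonal.
have Q1E i a : Q1 i a = d i * Q i a by rewrite /Q1 mul_diag_mx !mxE.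
have TQ1 : T = spectral_mx lam Q1.
  rewrite TQ; apply/matrixP => a b; rewrite !spectral_mxE.
  by apply: eq_bigr => i _; rewrite !Q1E mulrACA d2 mul1r.
clearbody Q1; pose U := Q1^T *m Q'.
have Uo : orthogonal_mx U by apply: orthogonal_mul => //; exact: orthogonal_tr.
have TU : T *m U = U *m T'.
  rewrite TQ' TQ1 /U /spectral_mx -!mulmxA.
  by rewrite (mulmxA Q1) Q1o mul1mx (mulmxA Q') Qo' mul1mx.
have hess S : isospectral lam S -> hessenberg_mx S.
  by move=> [_ St _] i j ij; rewrite St// ij orbT.
have Uu : upper_mx U.
  apply: (krylov_upper (hess _ Tiso) (hess _ Tiso') T'u TU) => a a0.
  have := orthogonal_col a ord0 Q1o; rewrite (negbTE a0) mulr0n /U mxE => h; rewrite -[RHS]h.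
  by apply: eq_bigr => i _; rewrite mxE [Q1 i ord0]Q1E dQ.
have Us : sign_mx U by apply: sign_mxP => //; exact: orthogonal_upper_diag.
by exists U; rewrite // -mulmxA TU mulmxA sign_mx_sqr// mul1mx.
Qed.

(** * Limits along ultrafilters *)

Lemma ultra_fmap (S T : Type) (f : S -> T) (U : set_system S) :
  UltraFilter U -> UltraFilter (f @ U).
Proof.
move=> UU; split; first exact: fmap_proper_filter.
move=> G GF fG; apply/seteqP; split => A; last exact: fG.
move=> GA; have [//|UnA] := in_ultra_setVsetC (f @^-1` A) UU.
have /filter_ex[x [//]] : G (A `&` ~` A) by apply: filterI => //; exact: fG.
Qed.

(** Convergence may be tested on ultrafilters, along which compactness provides
    limits; this avoids the extraction of subsequences. *)
Lemma cvg_ultra (T : topologicalType) (S : Type) (F : set_system S)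
    (f : S -> T) (l : T) {FF : Filter F} :
  (forall U, UltraFilter U -> F `<=` U -> f @ U --> l) -> f @ F --> l.
Proof.
move=> h A lA; apply: contrapT => nFA.
have G_proper : ProperFilter (filter_from F (fun B => B `&` ~` (f @^-1` A))).
  apply: filter_from_proper => [|B FB].
    apply: filter_from_filter; first by exists setT; exact: filterT.
    move=> B C FB FC; exists (B `&` C); first exact: filterI.
    by move=> x [[Bx Cx] nAx].
  apply: contrapT => B0; apply: nFA; apply: (@filterS _ F _ B _ _ FB) => x Bx.
  by apply: contrapT => nAx; apply: B0; exists x.
have [U [UU GU]] := ultraFilterLemma G_proper.
have FU : F `<=` U by move=> B FB; apply: GU; exists B => // x [].
have /filter_ex[x [Ax nAx]] : U (f @^-1` A `&` ~` (f @^-1` A)).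
  apply: filterI; first exact: (h U UU FU).
  by apply: GU; exists setT; [exact: filterT|move=> x []].
exact: nAx.
Qed.

Lemma ler_cvg (R : realType) (S : Type) (F : set_system S) (f g : S -> R)
    (a b : R) {FF : ProperFilter F} :
  (\forall t \near F, f t <= g t) ->
  f @ F --> a -> g @ F --> b -> a <= b.
Proof.
move=> fg fa gb; rewrite leNgt; apply/negP => ba.
have bm : b < (a + b) / 2 by lra.
have ma : (a + b) / 2 < a by lra.
have h1 : \forall t \near F, (a + b) / 2 < f t by exact: (cvgr_gt _ fa).
have h2 : \forall t \near F, g t < (a + b) / 2 by exact: (cvgr_lt _ gb).
have [t [[fgt ft] gt]] := @filter_ex _ F FF _ (filterI (filterI fg h1) h2).
by have := lt_trans ft (le_lt_trans fgt gt); rewrite ltxx.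
Qed.

Lemma cvg_harmonic_ultra (R : realType) (U : set_system nat) :
  \oo `<=` U -> (fun m => m.+1%:R^-1 : R) @ U --> (0 : R).
Proof. by move=> ooU A /cvg_harmonic /ooU. Qed.

Lemma cvg_mx (R : realType) (S : Type) m n (F : set_system S) (M : S -> 'M[R]_(m, n))
    (A : 'M[R]_(m, n)) {FF : Filter F} :
  (forall i j, (fun t => M t i j) @ F --> A i j) -> M @ F --> A.
Proof.
move=> h B [P PA PB]; rewrite /fmap /=.
have : \forall t \near F, forall i j, P i j (M t i j).
  apply: filter_forall => i; apply: filter_forall => j.
  exact: (h i j _ (PA i j)).
by apply: filterS => t Pt; exact: PB.
Qed.

Lemma cvg_coord (R : realType) (S : Type) m n (F : set_system S)
    (M : S -> 'M[R]_(m, n)) (A : 'M[R]_(m, n)) i j {FF : Filter F} :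
  M @ F --> A -> (fun t => M t i j) @ F --> A i j.
Proof.
move=> MA; exact: (cvg_comp _ (fun B : 'M[R]_(m, n) => B i j) MA (@coord_continuous R m n i j A)).
Qed.

Lemma cvg_mulmx (R : realType) (S : Type) m n p (F : set_system S)
    (M : S -> 'M[R]_(m, n)) (N : S -> 'M[R]_(n, p))
    (A : 'M[R]_(m, n)) (B : 'M[R]_(n, p)) {FF : Filter F} :
  M @ F --> A -> N @ F --> B -> (fun t => M t *m N t) @ F --> A *m B.
Proof.
move=> MA NB; apply: cvg_mx => i j; rewrite mxE.
under eq_fun do rewrite mxE.
apply: cvg_big => [|k _]; first exact: add_continuous.
by apply: cvgM; exact: cvg_coord.
Qed.

Lemma cvg_trmx (R : realType) (S : Type) m n (F : set_system S)
    (M : S -> 'M[R]_(m, n)) (A : 'M[R]_(m, n)) {FF : Filter F} :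
  M @ F --> A -> (fun t => (M t)^T) @ F --> A^T.
Proof.
move=> MA; apply: cvg_mx => i j; rewrite mxE.
by under eq_fun do rewrite mxE; exact: cvg_coord.
Qed.

Lemma cvg_unique_mx (R : realType) (S : Type) m n (F : set_system S)
    (M : S -> 'M[R]_(m, n)) (A B : 'M[R]_(m, n)) {FF : ProperFilter F} :
  M @ F --> A -> M @ F --> B -> A = B.
Proof.
move=> MA MB; apply/matrixP => i j.
by apply: (@cvg_unique _ (@Rhausdorff R) ((fun t => M t i j) @ F)); exact: cvg_coord.
Qed.

Lemma orthogonal_ultra (R : realType) (S : Type) n (U : set_system S)
    (Q : S -> 'M[R]_n) : UltraFilter U -> (forall t, orthogonal_mx (Q t)) ->
  exists2 P, orthogonal_mx P & Q @ U --> P.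
Proof.
move=> UU Qo.
have lim i j : exists x : R, (fun t => Q t i j) @ U --> x.
  have : compact (`[(-1 : R), 1]%classic) by exact: segment_compact.
  rewrite compact_ultra => /(_ ((fun t => Q t i j) @ U) (ultra_fmap _ UU)).
  case=> [|x [_ xU]]; last by exists x.
  have : U [set t | Q t i j \in `[-1, 1]]; last by [].
  by apply: filterE => t /=; have := orthogonal_le1 i j (Qo t); rewrite ler_norml in_itv.
have /choice[P PP] (ij : 'I_n * 'I_n) : exists x : R, (fun t => Q t ij.1 ij.2) @ U --> x.
  exact: lim.
have QP : Q @ U --> (\matrix_(i, j) P (i, j)).
  by apply: cvg_mx => i j; rewrite mxE; exact: (PP (i, j)).
exists (\matrix_(i, j) P (i, j)) => //.
apply: (@cvg_unique_mx _ _ _ _ U (fun t => Q t *m (Q t)^T)).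
  by apply: cvg_mulmx => //; exact: cvg_trmx.
by under eq_fun do rewrite Qo; exact: cvg_cst.
Qed.

Lemma cvg_spectral (R : realType) (S : Type) n (F : set_system S)
    (mu : 'I_n -> R) (Q : S -> 'M[R]_n) (P : 'M[R]_n) {FF : Filter F} :
  Q @ F --> P -> (fun t => spectral_mx mu (Q t)) @ F --> spectral_mx mu P.
Proof.
move=> QP; apply: cvg_mulmx => //; apply: cvg_mulmx; last exact: cvg_cst.
exact: cvg_trmx.
Qed.

Lemma cvg_eq0 (R : realType) (S : Type) (F : set_system S) (f : S -> R)
    (l : R) {FF : ProperFilter F} :
  (forall t, f t = 0) -> f @ F --> l -> l = 0.
Proof.
move=> f0 fl; apply: (@cvg_unique _ (@Rhausdorff R) (f @ F)) => //.
by rewrite (_ : f = cst 0); [exact: cvg_cst|apply/funext].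
Qed.

(** Compactness of the isospectral set: the eigenvector matrices have entries
    bounded by one, so they have a limit. *)
Lemma isospectral_ultra (R : realType) (S : Type) n (lam : 'I_n -> R)
    (U : set_system S) (T : S -> 'M[R]_n) : injective lam -> UltraFilter U ->
  (forall t, isospectral lam (T t)) ->
  exists2 T', isospectral lam T' & T @ U --> T'.
Proof.
move=> lam_inj UU Tiso.
have /choice[Q QP] t : exists Q, orthogonal_mx Q /\ T t = spectral_mx lam Q.
  by have [Q] := isospectral_spectral lam_inj (Tiso t); exists Q.
have [|P Po QU] := orthogonal_ultra (Q := Q) UU; first by move=> t; exact: (QP t).1.
have TP : T @ U --> spectral_mx lam P.
  rewrite (_ : T = fun t => spectral_mx lam (Q t)); first exact: cvg_spectral.
  by apply/funext => t; exact: (QP t).2.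
exists (spectral_mx lam P) => //; apply: isospectral_spectral_mx => // i j ij.
have TPij : (fun t => T t i j) @ U --> spectral_mx lam P i j by exact: cvg_coord.
apply: (cvg_eq0 _ TPij) => t.
by have [_ Tt _] := Tiso t; rewrite Tt// ij orbT.
Qed.

Lemma cvg_horner_mx (R : realType) (S : Type) n (p : {poly R})
    (F : set_system S) (T : S -> 'M[R]_n.+1) (A : 'M[R]_n.+1) {FF : Filter F} :
  T @ F --> A -> (fun t => horner_mx (T t) p) @ F --> horner_mx A p.
Proof.
move=> TA; elim/poly_ind: p => [|p c IH].
  rewrite (_ : (fun t => _) = fun=> horner_mx A 0); first exact: cvg_cst.
  by apply/funext => t; rewrite /= !rmorph0.
have pE (B : 'M[R]_n.+1) : horner_mx B (p * 'X + c%:P) = horner_mx B p *m B + c%:M.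
  by rewrite rmorphD rmorphM /= horner_mx_X horner_mx_C.
rewrite pE (_ : (fun t => _) = fun t => horner_mx (T t) p *m T t + c%:M); last first.
  exact/funext.
by apply: cvgD; [exact: cvg_mulmx|exact: cvg_cst].
Qed.

Lemma cvg_weight (R : realType) (S : Type) n (lam : 'I_n.+1 -> R) i a
    (F : set_system S) (T : S -> 'M[R]_n.+1) (A : 'M[R]_n.+1) {FF : Filter F} :
  T @ F --> A -> (fun t => weight lam i a (T t)) @ F --> weight lam i a A.
Proof.
move=> TA; apply: cvg_coord; exact: cvg_horner_mx.
Qed.

Arguments cvg_weight {R S n} lam i a {F T A FF} _.

Lemma cvg_continuous_in (R : realType) (S : Type) n (A : set 'M[R]_n)
    (F : 'M[R]_n -> 'M[R]_n) (U : set_system S) (T : S -> 'M[R]_n)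
    (T' : 'M[R]_n) {UU : Filter U} :
  {within A, continuous F} -> A T' -> (forall t, A (T t)) ->
  T @ U --> T' -> (fun t => F (T t)) @ U --> F T'.
Proof.
move=> /subspace_continuousP Fc AT' AT TT' B FB.
have := Fc T' AT' B FB; rewrite /fmap /= /within /= => /TT' h.
by apply: (@filterS _ U _ _ _ _ h) => t; exact.
Qed.

(** The orthogonal factors stay bounded, and any limit of them is an orthogonal
    factor for the limit of the triangular matrices; the arbitrary choice of
    signs does no harm. *)
Lemma chart_ultra (R : realType) (S : Type) n (mu : 'I_n -> R)
    (U : set_system S) (beta : S -> 'I_n -> R) (T : S -> 'M[R]_n) (beta' : 'I_n -> R) :
  UltraFilter U -> (forall t, in_chart mu (beta t) (T t)) ->
  (forall k, (fun t => beta t k) @ U --> beta' k) ->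
  exists2 T', in_chart mu beta' T' & T @ U --> T'.
Proof.
move=> UU Tc bb.
have [Q QP] := choice Tc.
have [|P Po QU] := orthogonal_ultra (Q := Q) UU; first by move=> t; have [] := QP t.
exists (spectral_mx mu P); last first.
  rewrite (_ : T = fun t => spectral_mx mu (Q t)); first exact: cvg_spectral.
  by apply/funext => t; have [] := QP t.
exists P; split => // i j ji.
have LL : (fun t => bidiag_eigen_mx mu (beta t)) @ U --> bidiag_eigen_mx mu beta'.
  apply: cvg_mx => a b; rewrite mxE; under eq_fun do rewrite mxE.
  apply: cvgM; first exact: cvg_cst.
  apply: cvg_big => [|k _]; first exact: mul_continuous.
  by apply: cvgM => //; exact: cvg_cst.
have QLij : (fun t => ((Q t)^T *m bidiag_eigen_mx mu (beta t)) i j) @ U -->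
    (P^T *m bidiag_eigen_mx mu beta') i j.
  by apply: cvg_coord; apply: cvg_mulmx => //; exact: cvg_trmx.
apply: (cvg_eq0 _ QLij) => t.
by have [_ h _] := QP t; exact: h.
Qed.

(** * Inverse spectral problem and paths to diagonal matrices *)

(** The first column of the unit triangular eigenvector matrix is proportional
    to the first components of the orthonormal eigenvectors, and it can be
    prescribed through the parameters. *)
Lemma inverse_spectral (R : realType) n (lam : 'I_n.+1 -> R) (w : 'I_n.+1 -> R) :
  injective lam -> (forall i, 0 < w i) -> \sum_i w i = 1 ->
  exists2 T, isospectral lam T & forall i, weight lam i ord0 T = w i.
Proof.
move=> lam_inj w0 w1.
pose z (i : 'I_n.+1) := Num.sqrt (w i) / Num.sqrt (w ord0) *
  \prod_(k < n.+1 | (k < i)%N) (lam i - lam k).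
have sw0 i : Num.sqrt (w i) != 0 by rewrite sqrtr_eq0 -ltNge.
have lam0 (i : 'I_n.+1) : \prod_(k < n.+1 | (k < i)%N) (lam i - lam k) != 0.
  apply/prodf_neq0 => k ki; rewrite subr_eq0 (inj_eq lam_inj) -val_eqE/=; lia.
have z0 i : z i != 0 by rewrite !mulf_neq0 ?invr_eq0.
(* The products of consecutive parameters telescope to [z]. *)
pose beta (k : 'I_n.+1) := if insub k.+1 is Some k' then z k' / z k else 0.
have prodE m (hm : (m < n.+1)%N) :
    \prod_(k < n.+1 | (k < m)%N) beta k = z (Ordinal hm).
  elim: m hm => [|m IH] hm.
    rewrite big_pred0//= /z big_pred0// mulr1 (_ : Ordinal hm = ord0) ?divff//.
    exact: val_inj.
  have hm' : (m < n.+1)%N by lia.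
  rewrite (bigD1 (Ordinal hm'))//= (eq_bigl (fun k : 'I_n.+1 => (k < m)%N)); last first.
    by move=> k; rewrite -val_eqE/=; lia.
  rewrite (IH hm') /beta /= insubT mulrAC mulrK ?unitfE//; congr (z _); exact: val_inj.
have [T Tc] := chart_ex lam beta; have [Q [Qo Qu TQ]] := Tc.
exists T; first exact: (chart_isospectral lam_inj erefl Tc).
have LE i : bidiag_eigen_mx lam beta i ord0 = Num.sqrt (w i) / Num.sqrt (w ord0).
  rewrite mxE leq0n mul1r big_split/= prodE (_ : Ordinal (ltn_ord i) = i); last exact: val_inj.
  by rewrite /z prodfV mulrK// unitfE.
have [P Pu QP] : exists2 P, upper_mx P & bidiag_eigen_mx lam beta = Q *m P.
  by exists (Q^T *m bidiag_eigen_mx lam beta); rewrite // mulmxA Qo mul1mx.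
have Q0 i : Q i ord0 * P ord0 ord0 = Num.sqrt (w i) / Num.sqrt (w ord0).
  rewrite -LE QP mxE (bigD1 ord0)//= big1 ?addr0// => k k0.
  by rewrite Pu ?mulr0// lt0n.
have P00 : P ord0 ord0 ^+ 2 = (w ord0)^-1.
  have : \sum_i (Q i ord0 * P ord0 ord0) ^+ 2 = (w ord0)^-1.
    rewrite (eq_bigr (fun i => w i * (w ord0)^-1)) => [|i _].
      by rewrite -mulr_suml w1 mul1r.
    by rewrite Q0 expr_div_n !sqr_sqrtr// ltW.
  move=> <-; under [RHS]eq_bigr do rewrite exprMn.
  rewrite -mulr_suml; have := orthogonal_col ord0 ord0 Qo.
  by rewrite eqxx mulr1n; under eq_bigr do rewrite -expr2; move=> ->; rewrite mul1r.
move=> i; rewrite TQ weight_spectral//.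
have w00 : w ord0 != 0 by rewrite gt_eqF.
have := congr1 (fun x => x ^+ 2) (Q0 i).
rewrite /= exprMn P00 expr_div_n !sqr_sqrtr ?ltW//.
by move=> /(mulIf _)->//; rewrite invr_eq0.
Qed.

Lemma binary_continuous_const (R : realType) (h : R -> R) :
  continuous h -> (forall t, h t = 0 \/ h t = 1) -> h 0 = h 1.
Proof.
move=> hc h01; have [//|h01'] := eqVneq (h 0) (h 1).
have [||c _ hc2] := @IVT R h 0 1 (1/2) (ltW ltr01).
- exact: continuous_subspaceT.
- have [h0|h0] := h01 0; have [h1|h1] := h01 1; rewrite h0 h1 ?eqxx// in h01' *;
    rewrite ge_min le_max; lra.
- by have [] := h01 c; rewrite hc2; lra.
Qed.

(** Shrinking the chart parameters joins a matrix to a diagonal one without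
    creating any new nonzero subdiagonal entry; along the way a continuous
    sign-invariant function with values in [{0, 1}] cannot change.  The endpoint
    is common to all such functions, so that an invariant can be compared with
    its composite with a self-map. *)
Lemma path_to_diagonal (R : realType) n (lam : 'I_n.+1 -> R)
    (T : 'M[R]_n.+1) (k k' : 'I_n.+1) : injective lam -> isospectral lam T ->
  k' = k.+1 :> nat -> T k' k = 0 ->
  exists D, [/\ isospectral lam D, is_diag_mx D &
  forall phi : 'M[R]_n.+1 -> R,
  (forall E S, sign_mx E -> isospectral lam S -> phi (E *m S *m E) = phi S) ->
  (forall (U : set_system R) (S : R -> 'M[R]_n.+1) S', UltraFilter U ->
    (forall t, isospectral lam (S t)) -> isospectral lam S' -> S @ U --> S' ->
    (fun t => phi (S t)) @ U --> phi S') ->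
  (forall S, isospectral lam S -> S k' k = 0 -> phi S = 0 \/ phi S = 1) ->
  phi T = phi D].
Proof.
move=> lam_inj Tiso k'k Tk; have [s [beta Tc]] := chart_cover lam_inj Tiso.
pose mu := lam \o s.
have mu_inj : injective mu by move=> i j /lam_inj/perm_inj.
have mulam : range mu = range lam by exact: range_perm.
have chart_iso b S := @chart_isospectral _ _ lam mu b S mu_inj mulam.
exists (diag_mx (\row_i mu i)); split.
- exact: chart_iso (in_chart0 mu).
- exact: diag_mx_is_diag.
move=> phi phi_sign phi_cont phi01.
have /choice[S Sc] (t : R) : exists S, in_chart mu (fun i => t * beta i) S.
  exact: chart_ex.
have Siso t := chart_iso _ _ (Sc t).
have phiE b S1 S2 : in_chart mu b S1 -> in_chart mu b S2 -> phi S1 = phi S2.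
  move=> c1 c2; have [E Es ->] := chart_unique c1 c2.
  by rewrite phi_sign//; exact: chart_iso c1.
have Sk t : S t k' k = 0.
  apply/eqP; rewrite (chart_subdiag mu_inj k'k (Sc t)) mulf_eq0; apply/orP; right.
  by rewrite -(chart_subdiag mu_inj k'k Tc) Tk.
have : phi (S 0) = phi (S 1).
  apply: (@binary_continuous_const _ (fun t => phi (S t))) => [t0|t]; last exact: phi01.
  apply: cvg_ultra => U UU tU.
  have [|S' S'c SS'] := @chart_ultra _ _ _ mu U _ S (fun i => t0 * beta i) UU Sc.
    by move=> i; apply: cvgM; [exact: tU|exact: cvg_cst].
  rewrite (phiE _ _ _ (Sc t0) S'c); apply: phi_cont => //; exact: chart_iso S'c.
rewrite (phiE _ (S 1) T (Sc 1)); last first.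
  by rewrite (_ : (fun i => _) = beta)//; apply/funext => i; rewrite mul1r.
rewrite (phiE _ (S 0) (diag_mx (\row_i mu i)) (Sc 0)) => [->//|].
rewrite (_ : (fun i => _) = fun=> 0); first exact: in_chart0.
by apply/funext => i; rewrite mul0r.
Qed.

(** * Surjectivity of equivariant self-maps *)

Lemma near_infty_div_lt (R : realType) (c e : R) (n : nat) : 0 < e ->
  \forall m \near \oo, c / (m + n.+1)%:R < e.
Proof.
move=> e0; exists (Num.bound `|c / e|) => // m /= hm.
rewrite ltr_pdivrMr ?ltr0n ?addnS// mulrC -ltr_pdivrMr//.
apply: le_lt_trans (ler_norm _) _.
apply: lt_le_trans (archi_boundP (normr_ge0 _)) _.
rewrite ler_nat; by apply: leq_trans hm _; lia.
Qed.

Section SelfMap.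
Variables (R : realType) (n : nat) (lam : 'I_n.+1 -> R).
Variable (F : 'M[R]_n.+1 -> 'M[R]_n.+1).
Hypothesis lam_inj : injective lam.
Hypothesis F_maps : set_fun (isospectral lam) (isospectral lam) F.
Hypothesis F_cont : {within isospectral lam, continuous F}.
Hypothesis F_equiv : sign_equivariant lam F.
Hypothesis F_diag : forall T : 'M[R]_n.+1,
  isospectral lam T -> is_diag_mx T -> F T = T.

Let F_iso T : isospectral lam T -> isospectral lam (F T).
Proof. exact: F_maps. Qed.

(** Flipping the signs of the leading block fixes [T], hence also [F T]. *)
Lemma selfmap_reduced T (k k' : 'I_n.+1) : isospectral lam T ->
  k' = k.+1 :> nat -> T k' k = 0 -> F T k' k = 0.
Proof.
move=> Tiso k'k Tk.
pose e : 'rV[R]_n.+1 := \row_a (if (a <= k)%N then 1 else -1).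
have Es : sign_mx (diag_mx e).
  by exists e => // a; rewrite mxE; case: ifP; [left|right].
have ETE : diag_mx e *m T *m diag_mx e = T.
  apply/matrixP => a b; rewrite sign_conjE !mxE.
  case: (leqP a k) => ak; case: (leqP b k) => bk; rewrite ?mul1r ?mulr1//.
  - by rewrite (reduced_block Tiso k'k Tk ak bk).1 mul0r.
  - by rewrite (reduced_block Tiso k'k Tk bk ak).2 mulr0.
  - by rewrite mulN1r mulrN1 opprK.
have := F_equiv Tiso Es; rewrite ETE => /matrixP/(_ k' k).
rewrite sign_conjE !mxE leqnn (_ : (k' <= k)%N = false); last by lia.
rewrite mulr1 mulN1r => h; lra.
Qed.

(** Equals one or zero when [T] splits after the row [k], according to whether
    [lam i] belongs to the leading block or not. *)
Definition head_mass i (k : 'I_n.+1) T :=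
  \sum_(a < n.+1 | (a <= k)%N) weight lam i a T.

Lemma head_mass01 i T (k k' : 'I_n.+1) : isospectral lam T ->
  k' = k.+1 :> nat -> T k' k = 0 -> head_mass i k T = 0 \/ head_mass i k T = 1.
Proof.
move=> Tiso k'k Tk; have [h|h] := weight_split i lam_inj Tiso k'k Tk.
  by left; apply: big1 => a; exact: h.
right; rewrite -(weight_total i lam_inj Tiso) [RHS](bigID (fun a : 'I_n.+1 => (a <= k)%N))/=.
by rewrite [X in _ = _ + X]big1 ?addr0// => a; rewrite -ltnNge; exact: h.
Qed.

(** Hence the two blocks keep their spectra: the mass is constant on the path
    from [T] to a diagonal matrix, both before and after applying [F], and [F]
    fixes the diagonal matrix. *)
Lemma head_mass_selfmap i T (k k' : 'I_n.+1) : isospectral lam T ->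
  k' = k.+1 :> nat -> T k' k = 0 -> head_mass i k (F T) = head_mass i k T.
Proof.
move=> Tiso k'k Tk.
have [D [Diso Dd const]] := path_to_diagonal lam_inj Tiso k'k Tk.
have hm_sign E S : sign_mx E -> isospectral lam S ->
    head_mass i k (E *m S *m E) = head_mass i k S.
  by move=> Es Siso; apply: eq_bigr => a _; rewrite weight_sign.
have hm_cont (U : set_system R) (S : R -> 'M[R]_n.+1) S' : UltraFilter U ->
    S @ U --> S' -> (fun t => head_mass i k (S t)) @ U --> head_mass i k S'.
  move=> UU SS'; apply: cvg_big => [|a _]; first exact: add_continuous.
  exact: cvg_weight.
rewrite (const (head_mass i k)) => [||U S S' UU _ _|S Siso]; last first.
- exact: head_mass01.
- exact: hm_cont.
- exact: hm_sign.
rewrite (const (fun S => head_mass i k (F S))) => [||U S S' UU Siso S'iso SS'|S Siso Sk].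
- by rewrite F_diag.
- by move=> E S Es Siso; rewrite F_equiv// hm_sign//; exact: F_iso.
- by apply: hm_cont; exact: (cvg_continuous_in F_cont).
- by apply: (head_mass01 _ _ k'k); [exact: F_iso|exact: selfmap_reduced].
Qed.

(** If the first component of an eigenvector vanishes, so does its whole part in
    the leading block cut off by the first zero of the subdiagonal. *)
Lemma weight0_selfmap i T : isospectral lam T -> weight lam i ord0 T = 0 ->
  weight lam i ord0 (F T) = 0.
Proof.
move=> Tiso w0.
pose zero_at m := [exists k : 'I_n.+1, [exists k' : 'I_n.+1,
  [&& (k : nat) == m, (k' : nat) == k.+1 & T k' k == 0]]].
have [m0 m0P] : exists m, zero_at m.
  apply: contrapT => nz; have := weight_total i lam_inj Tiso.
  rewrite big1 => [/eqP|a _]; first by rewrite eq_sym oner_eq0.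
  apply: (weight0_recurrence (m := n) lam_inj Tiso w0); last by rewrite -ltnS.
  move=> k k' k'k _; apply/eqP => Tk; apply: nz; exists (k : nat).
  by apply/existsP; exists k; apply/existsP; exists k'; rewrite !eqxx k'k Tk !eqxx.
case: (ex_minnP (ex_intro zero_at m0 m0P)) => m /existsP[k /existsP[k']].
move=> /and3P[/eqP km /eqP k'k /eqP Tk] m_min.
have wk (a : 'I_n.+1) : (a <= k)%N -> weight lam i a T = 0.
  apply: (weight0_recurrence lam_inj Tiso w0) => l l' l'l lk; apply/eqP => Tl.
  have : (m <= l)%N.
    by apply: m_min; apply/existsP; exists l; apply/existsP; exists l'; rewrite l'l Tl !eqxx.
  by rewrite -km leqNgt lk.
have : head_mass i k (F T) = 0.
  by rewrite (head_mass_selfmap _ Tiso k'k Tk); apply: big1 => a; exact: wk.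
move=> /eqP; rewrite psumr_eq0 => [/allP/(_ ord0 (mem_index_enum _))|a _].
  by rewrite leq0n => /eqP.
by apply: weight_ge0 => //; exact: F_iso.
Qed.

(** The preservation of faces, made uniform by compactness. *)
Lemma weight_threshold i (p : R) : 0 < p -> exists2 d, 0 < d &
  forall T, isospectral lam T -> weight lam i ord0 T < d ->
    weight lam i ord0 (F T) < p.
Proof.
move=> p0; apply: contrapT => nd.
have /choice[T TP] (m : nat) : exists T, [/\ isospectral lam T,
    weight lam i ord0 T < m.+1%:R^-1 & p <= weight lam i ord0 (F T)].
  apply: contrapT => nT; apply: nd; exists m.+1%:R^-1; first by rewrite invr_gt0.
  move=> T Tiso Tw; rewrite ltNge; apply/negP => pw; apply: nT; by exists T.
have [U [UU ooU]] := ultraFilterLemma eventually_filter.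
have Tiso m : isospectral lam (T m) by have [] := TP m.
have [T' T'iso TT'] := isospectral_ultra lam_inj UU Tiso.
have w0 : weight lam i ord0 T' = 0.
  apply/eqP; rewrite eq_le weight_ge0// andbT.
  have wU : (fun m => weight lam i ord0 (T m)) @ U --> weight lam i ord0 T'.
    exact: cvg_weight.
  apply: (ler_cvg _ wU (cvg_harmonic_ultra ooU)).
  by apply: filterE => m; have [_ /ltW] := TP m.
have FT : (fun m => weight lam i ord0 (F (T m))) @ U --> weight lam i ord0 (F T').
  by apply: cvg_weight; exact: (cvg_continuous_in F_cont).
have : p <= weight lam i ord0 (F T').
  apply: (ler_cvg _ (cvg_cst p) FT).
  by apply: filterE => m; have [_ _] := TP m.
by rewrite weight0_selfmap// leNgt p0.
Qed.

Lemma weight_selfmap_sign i E T : sign_mx E -> isospectral lam T ->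
  weight lam i ord0 (F (E *m T *m E)) = weight lam i ord0 (F T).
Proof. by move=> Es Tiso; rewrite F_equiv// weight_sign//; exact: F_iso. Qed.

Lemma weights_eq T p : isospectral lam T -> \sum_i p i = 1 ->
  (forall i, weight lam i ord0 T <= p i) -> forall i, weight lam i ord0 T = p i.
Proof.
move=> Tiso p1 wp i.
have : \sum_j (p j - weight lam j ord0 T) = 0.
  by rewrite sumrB p1 weight_sum// subrr.
move/eqP; rewrite psumr_eq0 => [/allP/(_ i (mem_index_enum _))|j _].
  by rewrite subr_eq0 => /eqP.
by rewrite subr_ge0.
Qed.

(** Label a grid point by the index of its smallest coordinate among those where
    the weight of the image is at most [p].  Near a face the vanishing
    coordinates are all eligible as labels, because the image is near that face
    too; choosing the smallest coordinate then prevents a cluster of labels from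
    accumulating at the boundary. *)
Theorem weights_onto p : (forall i, 0 < p i) -> \sum_i p i = 1 ->
  exists2 T, isospectral lam T & forall i, weight lam i ord0 (F T) = p i.
Proof.
move=> p0 p1.
have /choice[d dP] i : exists d, 0 < d /\ forall T, isospectral lam T ->
    weight lam i ord0 T < d -> weight lam i ord0 (F T) < p i.
  by have [d d0 dT] := weight_threshold i (p0 i); exists d.
(* Adding one to each coordinate keeps the grid inside the open simplex. *)
pose tot (x : 'I_n.+1 -> nat) : R := (\sum_a x a + n.+1)%:R.
have tot0 x : 0 < tot x by rewrite ltr0n addnS.
have /choice[J JP] (x : 'I_n.+1 -> nat) : exists T, isospectral lam T /\
    forall a, weight lam a ord0 T = (x a).+1%:R / tot x.
  have [|||T Tiso wT] := @inverse_spectral R n lam (fun a => (x a).+1%:R / tot x).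
  - exact: lam_inj.
  - by move=> a; rewrite divr_gt0// ltr0n.
  - rewrite -mulr_suml -natr_sum (eq_bigr (fun a => x a + 1)%N) => [|a _].
      by rewrite big_split/= sum1_card card_ord divff// gt_eqF// tot0.
    by rewrite addn1.
  - by exists T.
have Jiso x : isospectral lam (J x) by exact: (JP x).1.
pose ok x i := weight lam i ord0 (F (J x)) <= p i.
have /choice[c cP] (x : 'I_n.+1 -> nat) : exists i, ok x i /\
    forall j, ok x j -> (x i <= x j)%N.
  have [i0 i0ok] : exists i, ok x i.
    apply: contrapT => nok.
    have : \sum_i p i < \sum_i weight lam i ord0 (F (J x)).
      apply: ltr_sum => [|i _]; first by apply/hasP; exists ord0; rewrite ?mem_index_enum.
      by rewrite ltNge; apply/negP => h; apply: nok; exists i.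
    by rewrite p1 weight_sum ?ltxx//; exact: F_iso.
  case: (arg_minnP x (i0ok : ok x i0)) => i iok imin; by exists i.
have /choice[q /choice[S qP]] m := grid_scarf m c.
pose full m := forall i, c (q m i) = i.
have full_near : \forall m \near \oo, full m.
  have near_d : \forall m \near \oo, forall j, n.+2%:R / (m + n.+1)%:R < d j.
    by apply: filter_forall => j; apply: near_infty_div_lt; exact: (dP j).1.
  have near_big : \forall m \near \oo, (n.+1 * (n.+1 + n.+1) < m)%N.
    exact: nbhs_infty_gt.
  apply: filterS2 near_d near_big => m md mbig i.
  have [q_sum qS q_near q_out] := qP m.
  apply: (qS i).2; apply: contraT => iS.
  (* The missing index [i] is eligible everywhere, so that all coordinates are
     bounded, although they sum up to [m]. *)
  have q_ok l : ok (q m l) i.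
    apply: ltW; apply: (dP i).2 => //; rewrite (JP _).2 /tot q_sum.
    apply: le_lt_trans (md i); rewrite ler_pM2r ?invr_gt0 ?ltr0n ?addnS// ler_nat ltnS.
    exact: q_out.
  have q_small l : l \in S m -> (q m l l <= n.+1)%N.
    move=> lS; have := (cP (q m l)).2 i (q_ok l); rewrite (qS l).2//.
    by move=> h; apply: leq_trans h _; exact: q_out.
  have : (\sum_a q m i a <= n.+1 * (n.+1 + n.+1))%N.
    apply: (@leq_trans (\sum_(a < n.+1) (n.+1 + n.+1))); last by rewrite sum_nat_const card_ord.
    apply: leq_sum => a _; have [aS|aS] := boolP (a \in S m).
      by apply: leq_trans (q_near i a a) _; rewrite leq_add2r q_small.
    by apply: leq_trans (q_out i a aS) _; rewrite leq_addr.
  by rewrite q_sum leqNgt mbig.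
have [U [UU ooU]] := ultraFilterLemma eventually_filter.
have fullU : U full by exact: ooU.
have /choice[T TP] (i : 'I_n.+1) : exists T, isospectral lam T /\
    (fun m => J (q m i)) @ U --> T.
  have [|T Tiso TU] := isospectral_ultra (T := fun m => J (q m i)) lam_inj UU.
    by move=> m; exact: Jiso.
  by exists T.
have Tiso i : isospectral lam (T i) := (TP i).1.
have wU i a : (fun m => weight lam a ord0 (J (q m i))) @ U -->
    weight lam a ord0 (T i).
  by apply: cvg_weight; exact: (TP i).2.
have wle i j a : weight lam a ord0 (T i) <= weight lam a ord0 (T j).
  have gap : (fun m => n.+1%:R / (m + n.+1)%:R : R) @ U --> (0 : R).
    apply: (cvg_trans (cvg_app _ ooU)); apply/cvgrPdist_lt => e e0.
    apply: filterS (near_infty_div_lt n.+1%:R n e0) => m.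
    by rewrite sub0r normrN ger0_norm// divr_ge0.
  have wUj : (fun m => weight lam a ord0 (J (q m j)) + n.+1%:R / (m + n.+1)%:R) @ U -->
      weight lam a ord0 (T j) + 0 by exact: cvgD.
  rewrite -[leRHS]addr0; apply: (ler_cvg _ (wU i a) wUj).
  apply: filterE => m /=; have [q_sum _ q_near _] := qP m.
  rewrite !(JP _).2 /tot !q_sum -mulrDl ler_pM2r ?invr_gt0 ?ltr0n ?addnS//.
  by rewrite -natrD ler_nat addSn ltnS; exact: q_near.
have wE i j a : weight lam a ord0 (T i) = weight lam a ord0 (T j).
  by apply/eqP; rewrite eq_le !wle.
have w0 i a : 0 < weight lam a ord0 (T i).
  rewrite lt_neqAle weight_ge0// andbT eq_sym; apply/eqP => wa0.
  suff all0 b : weight lam b ord0 (T i) <= 0.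
    have := weight_sum ord0 lam_inj (Tiso i); rewrite big1 => [/eqP|b _].
      by rewrite eq_sym oner_eq0.
    by apply/eqP; rewrite eq_le all0 weight_ge0.
  rewrite (wE i b) -wa0 (wE i b a); apply: (ler_cvg _ (wU b b) (wU b a)).
  have small : U [set m | weight lam a ord0 (J (q m b)) < d a].
    by apply: (cvgr_lt _ (wU b a)); rewrite (wE b i) wa0; exact: (dP a).1.
  apply: filterS2 fullU small => m mfull ma.
  rewrite !(JP _).2 ler_pM2r ?invr_gt0 ?tot0// ler_nat ltnS.
  have := (cP (q m b)).2 a; rewrite mfull; apply.
  by apply: ltW; apply: (dP a).2.
exists (T ord0) => //; apply: weights_eq => // [|i]; first exact: F_iso.
have Tu j : unreduced (T j) by apply: (weight_unreduced lam_inj (Tiso j)) => a; exact: w0.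
have [E Es ->] := weight_inj lam_inj (Tiso i) (Tiso ord0) (Tu ord0) (wE i ord0).
rewrite weight_selfmap_sign//.
have FT : (fun m => weight lam i ord0 (F (J (q m i)))) @ U -->
    weight lam i ord0 (F (T i)).
  by apply: cvg_weight; apply: (cvg_continuous_in F_cont) => //; exact: (TP i).2.
apply: (ler_cvg _ FT (cvg_cst (p i))).
apply: filterS fullU => m mfull; have := (cP (q m i)).1; rewrite mfull; exact.
Qed.

Lemma unreduced_in_image T : isospectral lam T -> unreduced T ->
  exists2 S, isospectral lam S & F S = T.
Proof.
move=> Tiso Tu.
have [||S Siso wS] := @weights_onto (fun i => weight lam i ord0 T).
- by move=> i; exact: unreduced_weight.
- exact: weight_sum.
have [E Es TE] := weight_inj lam_inj (F_iso Siso) Tiso Tu wS.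
exists (E *m S *m E); first exact: isospectral_sign.
by rewrite F_equiv.
Qed.

(** Replacing the zeros among the chart parameters of [T] by [1 / (m + 1)] gives
    matrices with nonzero subdiagonal, which have preimages; a limit of these is
    a preimage of [T] up to signs. *)
Theorem selfmap_surj : set_surj (isospectral lam) (isospectral lam) F.
Proof.
move=> T Tiso /=.
have [s [beta Tc]] := chart_cover lam_inj Tiso.
pose mu := lam \o s.
have mu_inj : injective mu by move=> i j /lam_inj/perm_inj.
have mulam : range mu = range lam by exact: range_perm.
pose b (m : nat) i := beta i + (beta i == 0)%:R * m.+1%:R^-1.
have /choice[S Sc] m : exists S, in_chart mu (b m) S by exact: chart_ex.
have Siso m := chart_isospectral mu_inj mulam (Sc m).
have Su m : unreduced (S m).
  move=> i j ij; rewrite (chart_subdiag mu_inj ij (Sc m)) /b.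
  by case: (eqVneq (beta j) 0) => [->|]; rewrite ?mul0r ?addr0// mul1r add0r invr_eq0.
have /choice[V VP] m : exists V, isospectral lam V /\ F V = S m.
  by have [V] := unreduced_in_image (Siso m) (Su m); exists V.
have [U [UU ooU]] := ultraFilterLemma eventually_filter.
have [|T' T'c ST'] := @chart_ultra _ _ _ mu U b S beta UU Sc.
  move=> k; rewrite -[X in _ --> X]addr0 -[X in _ --> _ + X](mulr0 (beta k == 0)%:R).
  apply: cvgD; first exact: cvg_cst.
  by apply: cvgM; [exact: cvg_cst|exact: cvg_harmonic_ultra].
have Viso m : isospectral lam (V m) := (VP m).1.
have [V' V'iso VV'] := isospectral_ultra lam_inj UU Viso.
have FV' : F V' = T'.
  apply: (cvg_unique_mx (F := U) (M := fun m => F (V m))).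
    exact: (cvg_continuous_in F_cont).
  by rewrite (_ : (fun m => _) = S)//; apply/funext => m; exact: (VP m).2.
have [E Es TE] := chart_unique T'c Tc.
by exists (E *m V' *m E); [exact: isospectral_sign|rewrite F_equiv// FV'].
Qed.

End SelfMap.

(** * Orbits that do not deflate *)

Section Deflation.
Variables (R : realType) (n : nat) (lam : 'I_n.+2 -> R).
Hypothesis lam_inj : injective lam.

Local Notation last := (ord_max : 'I_n.+2).
Local Notation prev := (inord n : 'I_n.+2).

Lemma prev_val : prev = n :> nat. Proof. by rewrite inordK. Qed.

Lemma prev_neq_last : prev != last.
Proof. by rewrite -val_eqE/= prev_val; lia. Qed.

(** The reflections along [e_last + t e_prev] interpolate between the identity,
    up to sign, at [t = 0] and the exchange of the last two basis vectors, up to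
    sign, at [t = 1]. *)
Definition swap_vector (t : R) : 'cV[R]_n.+2 :=
  \col_i ((i == last)%:R + t * (i == prev)%:R).

Definition swap_path (t : R) : 'M[R]_n.+2 :=
  spectral_mx lam (reflection_mx (swap_vector t)).

Lemma swap_mxE t i a : reflection_mx (swap_vector t) i a =
  (i == a)%:R - 2 / (1 + t ^+ 2) * (swap_vector t i ord0 * swap_vector t a ord0).
Proof.
rewrite !mxE big_ord1 !mxE; congr (_ - _ / _ * _).
rewrite (bigD1 last)//= (bigD1 prev) ?prev_neq_last//= big1 ?addr0 => [|j /andP[jl jp]].
  rewrite !mxE !eqxx (negbTE prev_neq_last) eq_sym (negbTE prev_neq_last).
  by rewrite mulr0 mulr1 addr0 add0r expr1n.
by rewrite !mxE (negbTE jl) (negbTE jp) mulr0 addr0 expr0n.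
Qed.

Lemma swap_vector_last t : swap_vector t last ord0 = 1.
Proof. by rewrite mxE eqxx eq_sym (negbTE prev_neq_last) mulr0 addr0. Qed.

Lemma swap_vector_prev t : swap_vector t prev ord0 = t.
Proof. by rewrite mxE eqxx (negbTE prev_neq_last) mulr1 add0r. Qed.

Lemma swap_vector_other t i : i != last -> i != prev -> swap_vector t i ord0 = 0.
Proof. by move=> /negbTE il /negbTE ip; rewrite mxE il ip mulr0 addr0. Qed.

Lemma swap_path_isospectral t : isospectral lam (swap_path t).
Proof.
apply: isospectral_spectral_mx => //; first exact: reflection_mx_orthogonal.
move=> a b ba; rewrite spectral_mxE.
have vb : swap_vector t b ord0 = 0.
  apply: swap_vector_other; rewrite -val_eqE/= ?prev_val; have := ltn_ord a; lia.
rewrite (bigD1 b)//= big1 => [|i ib]; rewrite !swap_mxE vb.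
  rewrite mul0r mulr0 subr0 (_ : (b == a) = false) ?mul0r ?mulr0 ?addr0//.
  by rewrite -val_eqE/=; lia.
by rewrite (negbTE ib) !mulr0 subr0 !mulr0.
Qed.

Lemma swap_path_last t a : swap_path t last a =
  lam last * ((1 - 2 / (1 + t ^+ 2)) * reflection_mx (swap_vector t) last a) -
  lam prev * (2 / (1 + t ^+ 2) * t * reflection_mx (swap_vector t) prev a).
Proof.
rewrite /swap_path spectral_mxE (bigD1 last)//= (bigD1 prev) ?prev_neq_last//=.
rewrite big1 ?addr0 => [|i /andP[il ip]]; last first.
  rewrite [reflection_mx _ i last]swap_mxE (swap_vector_other _ il ip) (negbTE il).
  by rewrite mul0r mulr0 subr0 mul0r mulr0.
rewrite [reflection_mx _ last last]swap_mxE [reflection_mx _ prev last]swap_mxE.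
rewrite eqxx (negbTE prev_neq_last) !swap_vector_last swap_vector_prev.
by rewrite mulr1n mulr0n; ring.
Qed.

Lemma swap_path0 : deflation_set lam last (swap_path 0).
Proof.
split; first exact: swap_path_isospectral.
  rewrite /bottom swap_path_last !swap_mxE eq_sym (negbTE prev_neq_last).
  by rewrite !swap_vector_last !swap_vector_prev eqxx mulr1n mulr0n; field.
rewrite swap_path_last !swap_mxE (negbTE prev_neq_last).
by rewrite !swap_vector_last !swap_vector_prev eqxx mulr1n mulr0n; field.
Qed.

Lemma swap_path1 : deflation_set lam prev (swap_path 1).
Proof.
split; first exact: swap_path_isospectral.
  rewrite /bottom swap_path_last !swap_mxE eq_sym (negbTE prev_neq_last).
  by rewrite !swap_vector_last !swap_vector_prev eqxx mulr1n mulr0n; field.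
rewrite swap_path_last !swap_mxE (negbTE prev_neq_last).
by rewrite !swap_vector_last !swap_vector_prev eqxx mulr1n mulr0n; field.
Qed.

Lemma cvg_swap_path (t : R) : swap_path x @[x --> t] --> swap_path t.
Proof.
apply: cvg_spectral; apply: cvg_mx => i a; rewrite swap_mxE.
under eq_fun do rewrite swap_mxE.
have cv j : swap_vector x j ord0 @[x --> t] --> swap_vector t j ord0.
  rewrite mxE; under eq_fun do rewrite mxE.
  apply: cvgD; first exact: cvg_cst.
  by apply: cvgM; [exact: cvg_id|exact: cvg_cst].
apply: cvgB; first exact: cvg_cst.
apply: cvgM; last exact: cvgM.
apply: cvgM; first exact: cvg_cst.
apply: cvgV; first by rewrite gt_eqF// ltr_pwDl// sqr_ge0.
apply: cvgD; first exact: cvg_cst.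
by rewrite expr2; under eq_fun do rewrite expr2; apply: cvgM; exact: cvg_id.
Qed.

Variable F : 'M[R]_n.+2 -> 'M[R]_n.+2.
Hypothesis F_iso : forall T, isospectral lam T -> isospectral lam (F T).
Hypothesis F_cont : {within isospectral lam, continuous F}.

Lemma iter_iso k T : isospectral lam T -> isospectral lam (iter k F T).
Proof. by move=> Tiso; elim: k => //= k; exact: F_iso. Qed.

Lemma cvg_iter (S : Type) (G : set_system S) {GF : Filter G} (k : nat)
    (T : S -> 'M[R]_n.+2) (T' : 'M[R]_n.+2) :
  (forall t, isospectral lam (T t)) -> isospectral lam T' -> T @ G --> T' ->
  (fun t => iter k F (T t)) @ G --> iter k F T'.
Proof.
move=> Tiso T'iso TT'; elim: k => [//|k IH] /=.
apply: (cvg_continuous_in F_cont) => [|t|//]; exact: iter_iso.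
Qed.

Lemma near_relative_interior (S : Type) (G : set_system S) {GF : Filter G}
    (K : set 'M[R]_n.+2) (T : S -> 'M[R]_n.+2) (T' : 'M[R]_n.+2) :
  (forall t, isospectral lam (T t)) -> isospectral lam T' -> T @ G --> T' ->
  relative_interior (isospectral lam) K T' ->
  \forall t \near G, relative_interior (isospectral lam) K (T t).
Proof.
move=> Tiso T'iso TT' KT'.
have : nbhs (T' : subspace (isospectral lam)) (relative_interior (isospectral lam) K).
  exact: nbhs_interior KT'.
rewrite /nbhs /= -nbhs_subspace_in// /within /= => /TT' h.
by apply: (@filterS _ G _ _ _ _ h) => t; apply; exact: Tiso.
Qed.

(** The last diagonal entry is then an eigenvalue. *)
Lemma bottom0_deflation T : isospectral lam T -> bottom T = 0 ->
  exists i, deflation_set lam i T.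
Proof.
move=> Tiso Tb; have [_ _ spec] := Tiso.
suff : [set a | eigenvalue T a] (T last last).
  by rewrite spec => -[i _ iE]; exists i.
have lp : (last : nat) = prev.+1 by rewrite prev_val.
apply/eigenvalueP; exists (delta_mx ord0 last).
  rewrite -rowE; apply/rowP => a; rewrite !mxE eqxx /=.
  have [->|al] := eqVneq a last; first by rewrite mulr1.
  have ap : (a <= prev)%N.
    by move: al; rewrite -val_eqE/= prev_val; have := ltn_ord a; lia.
  by rewrite mulr0 (reduced_block Tiso lp Tb ap _).2// prev_val.
apply/eqP => /rowP/(_ last); rewrite !mxE !eqxx => /eqP; by rewrite oner_eq0.
Qed.

Variable K : 'I_n.+2 -> set 'M[R]_n.+2.
Hypothesis K_triv : trivIset setT K.
Hypothesis K_deflation : forall i, deflation_set lam i `<=` K i.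
Hypothesis K_trap :
  forall i, F @` K i `<=` relative_interior (isospectral lam) (K i).

Definition basin i T :=
  exists k, relative_interior (isospectral lam) (K i) (iter k F T).

Let K_F i T : K i T -> relative_interior (isospectral lam) (K i) (F T).
Proof. by move=> KT; apply: K_trap; exists T. Qed.

Let relint_sub i T : relative_interior (isospectral lam) (K i) T -> K i T.
Proof. exact: interior_subset. Qed.

Lemma basin_uniq i j T : basin i T -> basin j T -> i = j.
Proof.
move=> [k ik] [l jl].
have stay m a b : relative_interior (isospectral lam) (K m) (iter a F T) ->
    K m (iter (b + a) F T).
  by move=> /relint_sub h; elim: b => // b /K_F/relint_sub.
apply: K_triv => //; exists (iter (l + k) F T); split; first exact: stay.
by rewrite addnC; exact: stay.
Qed.

Lemma deflation_basin i T : deflation_set lam i T -> basin i T.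
Proof. by move=> /K_deflation/K_F; exists 1%N. Qed.

(** A limit point of the orbit lies in some deflation set, and the next iterate
    lies in the interior of the corresponding trap. *)
Lemma bottom_deflation_basin T : isospectral lam T -> bottom_deflation F T ->
  exists i, basin i T.
Proof.
move=> Tiso Tdefl.
have [U [UU ooU]] := ultraFilterLemma eventually_filter.
have Tk k := iter_iso k Tiso.
have [S Siso TS] := isospectral_ultra lam_inj UU Tk.
have Sb : bottom S = 0.
  apply: (@cvg_unique _ (@Rhausdorff R) ((fun k => bottom (iter k F T)) @ U)).
    exact: cvg_coord.
  by move=> A /Tdefl /ooU.
have [i Si] := bottom0_deflation Siso Sb.
have FS := K_F (K_deflation Si).
exists i.
have FU : (fun k => F (iter k F T)) @ U --> F S.
  exact: (cvg_continuous_in F_cont).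
have Fk k : isospectral lam (F (iter k F T)) by exact: F_iso.
have [k hk] := @filter_ex _ U _ _ (near_relative_interior Fk (F_iso Siso) FU FS).
by exists k.+1.
Qed.

(** If every orbit deflates, the basins met by the swap path form a partition of
    the line into open sets, two of which are nonempty. *)
Lemma non_deflating : exists T, isospectral lam T /\ ~ bottom_deflation F T.
Proof.
apply: contrapT => all_defl.
have cover t : exists i, basin i (swap_path t).
  apply: bottom_deflation_basin; first exact: swap_path_isospectral.
  apply: contrapT => nd; apply: all_defl.
  by exists (swap_path t); split => //; exact: swap_path_isospectral.
have openB i t : basin i (swap_path t) -> \forall x \near t, basin i (swap_path x).
  move=> [k ik].
  have Gk : iter k F (swap_path x) @[x --> t] --> iter k F (swap_path t).
    by apply: cvg_iter (@cvg_swap_path t) => [x|]; exact: swap_path_isospectral.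
  have : \forall x \near t,
      relative_interior (isospectral lam) (K i) (iter k F (swap_path x)).
    by apply: near_relative_interior Gk ik => [x|]; apply: iter_iso;
      exact: swap_path_isospectral.
  by apply: filterS => x kx; exists k.
pose h (t : R) : R := `[< basin last (swap_path t) >]%:R.
have h01 t : h t = 0 \/ h t = 1 by rewrite /h; case: asboolP; [right|left].
have hc : continuous h.
  move=> t A At; have [i it] := cover t.
  apply: (@filterS _ (nbhs t) _ _ _ _ (openB i t it)) => x ix.
  rewrite /= (_ : h x = h t); first exact: nbhs_singleton.
  rewrite /h; congr (_%:R); congr nat_of_bool; apply/asbool_equiv_eq; split => b.
    by rewrite (basin_uniq b ix).
  by rewrite (basin_uniq b it).
have := binary_continuous_const hc h01.
have -> : h 0 = 1.
  by rewrite /h; case: asboolP => // -[]; apply: deflation_basin; exact: swap_path0.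
have -> : h 1 = 0.
  rewrite /h; case: asboolP => // b.
  have := basin_uniq b (deflation_basin swap_path1).
  by move/eqP; rewrite eq_sym (negbTE prev_neq_last).
by move/eqP; rewrite oner_eq0.
Qed.

End Deflation.

Theorem theorem1 (R : realType) (n : nat) (lam : 'I_n.+2 -> R)
    (lam_incr : forall i j : 'I_n.+2, (i < j)%N -> lam i < lam j)
    (F : 'M[R]_n.+2 -> 'M[R]_n.+2)
    (F_maps : set_fun (isospectral lam) (isospectral lam) F)
    (F_cont : {within isospectral lam, continuous F})
    (F_equiv : sign_equivariant lam F)
    (F_diag : forall T : 'M[R]_n.+2,
        isospectral lam T -> is_diag_mx T -> F T = T) :
  set_surj (isospectral lam) (isospectral lam) F /\
  ((exists K : 'I_n.+2 -> set 'M[R]_n.+2,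
      [/\ trivIset setT K,
          forall i, K i `<=` isospectral lam,
          forall i, compact (K i),
          forall i, deflation_set lam i `<=` K i
        & forall i, F @` K i `<=` relative_interior (isospectral lam) (K i)]) ->
   exists T : 'M[R]_n.+2, isospectral lam T /\ ~ bottom_deflation F T).
Proof.
have lam_inj : injective lam.
  move=> i j lij; apply: val_inj; have [/lam_incr|/lam_incr|//] := ltngtP i j.
    by rewrite lij ltxx.
  by rewrite lij ltxx.
split; first exact: selfmap_surj.
move=> [K [K_triv _ _ K_deflation K_trap]].
exact: (@non_deflating _ _ _ lam_inj F F_maps F_cont K).
Qed.
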